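(* Let $p\in(\tfrac14,\tfrac13]$ and $\mathbf s,\mathbf t,\mathbf r\in\mathds S$, and let $\mathcal F=\mathcal F(\mathbf s,\mathbf t,\mathbf r)$ be the corresponding generalised $p$-Koch snowflake with its parameterisation $\gamma:[0,1]\to\mathcal F$. If $\gamma$ is injective on $[0,1)$, then $\mathcal F$ is of bounded turning, that is, there exists a constant $K\in[1,\infty)$ such that for all $x,y\in\mathcal F$ there exists a compact connected set $\Gamma\subseteq\mathcal F$ containing $x$ and $y$ with $\operatorname{diam}(\Gamma)\le K\,|x-y|$.
   Context: Notation: $\mathbb N=\{1,2,\dots\}$, $\mathbb N_0=\mathbb N\cup\{0\}$, $p\in(\tfrac14,\tfrac13]$, $q=\sqrt{4p-1}$, $|\cdot|$ is the Euclidean norm. $V\subset\mathbb R^2$ is the closed filled-in rhombus (closed convex hull) with vertices $P_\pm=(\pm\tfrac12,0)$ and $Q_\pm=(0,\pm\tfrac12 q)$. Maps: for $(a,b)\in A=\{0,1,2,3\}\times\{0,1\}$ the affine maps $\phi_{(a,b)}$ (which map $V$ into $V$) are $\phi_{(0,0)}(x,y)=\phi_{(0,1)}(x,y)=(px-\tfrac{1-p}{2},\,py)$; $\phi_{(3,0)}(x,y)=\phi_{(3,1)}(x,y)=(px+\tfrac{1-p}{2},\,py)$; $\phi_{(1,0)}(x,y)=\big(\tfrac12((1-2p)x-qy)+\tfrac{2p-1}{4},\ \tfrac12(qx+(1-2p)y)+\tfrac q4\big)$; $\phi_{(2,0)}(x,y)=\big(\tfrac12((1-2p)x+qy)+\tfrac{1-2p}{4},\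 \tfrac12(-qx+(1-2p)y)+\tfrac q4\big)$; $\phi_{(1,1)}(x,y)=\big(\tfrac12((1-2p)x+qy)+\tfrac{2p-1}{4},\ \tfrac12(-qx+(1-2p)y)-\tfrac q4\big)$; $\phi_{(2,1)}(x,y)=\big(\tfrac12((1-2p)x-qy)+\tfrac{1-2p}{4},\ \tfrac12(qx+(1-2p)y)-\tfrac q4\big)$. Generalised $p$-Koch curves: an element $\mathbf s\in\mathds S=\prod_{k=0}^\infty\{0,1\}^{4^k}$ is written $\mathbf s=((s_k(0),s_k(1),\dots,s_k(4^k-1)))_{k=0}^\infty$ with $s_k(i)\in\{0,1\}$. For $\mathbf u=(u_k)_{k\in\mathbb N}\in\{0,1,2,3\}^{\mathbb N}$ put $\omega_1(\mathbf u,\mathbf s)=(u_1,s_0(0))$ and, for $k\ge2$, $\omega_k(\mathbf u,\mathbf s)=\big(u_k,\,s_{k-1}(\sum_{j=1}^{k-1}u_j4^{k-1-j})\big)\in A$; write $\omega(\mathbf u,\mathbf s)=(\omega_k(\mathbf u,\mathbf s))_{k\in\mathbb N}$. For $\omega\in A^{\mathbb N}$, $\pi(\omega)$ denotes the unique element of $\bigcap_{k\in\mathbb N}(\phi_{\omega_1}\circ\cdots\circ\phi_{\omega_k})(V)$. The generalised $p$-Koch curve associated with $\mathbf s$ is $\mathcal C(\mathbf s)=\{\pi(\omega(\mathbf u,\mathbf s)):\mathbf u\in\{0,1,2,3\}^{\mathbb N}\}$. Its parameterisation $\rho_{\mathbf s}:[0,1]\to\mathcal C(\mathbf s)$ is $\rho_{\mathbf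 s}(t)=\pi(\omega(\mathbf u,\mathbf s))$, where $\mathbf u=(u_k)_{k\in\mathbb N}\in\{0,1,2,3\}^{\mathbb N}$ is any sequence with $t=\sum_{k\in\mathbb N}u_k4^{-k}$ (the value does not depend on the chosen base 4 expansion). Generalised $p$-Koch snowflakes: let $f_1(x,y)=\big(-\tfrac12x+\tfrac{\sqrt3}{2}y+\tfrac14,\ -\tfrac{\sqrt3}{2}x-\tfrac12y-\tfrac{\sqrt3}{4}\big)$ and $f_2(x,y)=\big(-\tfrac12x-\tfrac{\sqrt3}{2}y-\tfrac14,\ \tfrac{\sqrt3}{2}x-\tfrac12y-\tfrac{\sqrt3}{4}\big)$. For $\mathbf s,\mathbf t,\mathbf r\in\mathds S$, $\mathcal F(\mathbf s,\mathbf t,\mathbf r)=\mathcal C(\mathbf s)\cup f_1(\mathcal C(\mathbf t))\cup f_2(\mathcal C(\mathbf r))$. Its parameterisation $\gamma:[0,1]\to\mathcal F(\mathbf s,\mathbf t,\mathbf r)$ is $\gamma(t)=\rho_{\mathbf s}(1-3t)$ for $t\in[0,\tfrac13)$, $\gamma(t)=f_2(\rho_{\mathbf r}(2-3t))$ for $t\in[\tfrac13,\tfrac23)$, and $\gamma(t)=f_1(\rho_{\mathbf t}(3-3t))$ for $t\in[\tfrac23,1]$. *)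

(* Defs.v *)
From HB Require Import structures.
From mathcomp Require Import all_boot all_order all_algebra.
From mathcomp Require Import all_classical all_reals all_analysis.

Set Implicit Arguments.
Unset Strict Implicit.
Unset Printing Implicit Defensive.

Import Order.TTheory GRing.Theory Num.Theory.
Import numFieldNormedType.Exports.

Local Open Scope classical_set_scope.
Local Open Scope ring_scope.

(** The topology of [plane R] is the product topology. The canonical norm of a
    product is the sup norm, hence the separate Euclidean norm [enorm], which
    is the one used for distances and diameters. *)
Definition plane (R : realType) := (R^o * R^o)%type.

Definition enorm (R : realType) (x : plane R) : R :=
  Num.sqrt (x.1 ^+ 2 + x.2 ^+ 2).

(** [ediam set0 = -oo]; a nonempty unbounded set has diameter [+oo]. *)
Definition ediam (R : realType) (A : set (plane R)) : \bar R :=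
  ereal_sup [set (enorm (z.1 - z.2))%:E | z in A `*` A].

Definition bounded_turning (R : realType) (F : set (plane R)) : Prop :=
  exists2 K : R, 1 <= K &
    forall x y : plane R, F x -> F y ->
      exists G : set (plane R),
        [/\ G `<=` F, compact G /\ connected G, G x, G y &
            (ediam G <= (K * enorm (x - y))%:E)%E].

Definition qpar (R : realType) (p : R) : R := Num.sqrt (4 * p - 1).

(** Closed convex hull of the four vertices. *)
Definition rhombus (R : realType) (p : R) : set (plane R) :=
  smallest [set A : set (plane R) |
             closed A /\ convex_set (A : set (convex_lmodType (plane R)))]
    [set x : plane R | x \in [:: (- (1 / 2), 0); (1 / 2, 0);
                                 (0, - (qpar p / 2)); (0, qpar p / 2)]].

Definition letter := ('I_4 * 'I_2)%type.

Definition phi (R : realType) (p : R) (a : letter) (z : plane R) : plane R :=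
  let q := qpar p in
  let: (x, y) := z in
  match val a.1, val a.2 with
  | 0%N, _ => (p * x - (1 - p) / 2, p * y)
  | 1%N, 0%N => (((1 - 2 * p) * x - q * y) / 2 + (2 * p - 1) / 4,
                 (q * x + (1 - 2 * p) * y) / 2 + q / 4)
  | 2%N, 0%N => (((1 - 2 * p) * x + q * y) / 2 + (1 - 2 * p) / 4,
                 (- q * x + (1 - 2 * p) * y) / 2 + q / 4)
  | 1%N, _ => (((1 - 2 * p) * x + q * y) / 2 + (2 * p - 1) / 4,
               (- q * x + (1 - 2 * p) * y) / 2 - q / 4)
  | 2%N, _ => (((1 - 2 * p) * x - q * y) / 2 + (1 - 2 * p) / 4,
               (q * x + (1 - 2 * p) * y) / 2 - q / 4)
  | _, _ => (p * x + (1 - p) / 2, p * y)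
  end.

(** Sequences indexed by [{1, 2, ...}] in the mathematics are functions on
    [nat] starting at 0: [u i] is the term of index [i + 1]. *)
Definition phi_word (R : realType) (p : R) (w : nat -> letter) (k : nat) :
    plane R -> plane R :=
  \big[comp/idfun]_(i < k) phi p (w i).

(** For [1/4 < p <= 1/3] the intersection is a singleton, and [coding p w] is
    its element; the default value [0] is irrelevant. *)
Definition coding (R : realType) (p : R) (w : nat -> letter) : plane R :=
  xget 0 (\bigcap_k (phi_word p w k.+1 @` rhombus p)).

Definition orientations := forall k : nat, {ffun 'I_(4 ^ k) -> 'I_2}.

Definition base4_prefix (u : nat -> 'I_4) (i : nat) : nat :=
  (\sum_(j < i) u j * 4 ^ (i - j.+1))%N.

Lemma base4_prefix_lt (u : nat -> 'I_4) (i : nat) :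
  (base4_prefix u i < 4 ^ i)%N.
Proof.
rewrite /base4_prefix; elim: i => [|i IHi]; first by rewrite big_ord0.
rewrite big_ord_recr /= subnn expn0 muln1.
under eq_bigr => j _ do rewrite subSn // expnSr mulnA.
rewrite -big_distrl /= expnSr.
apply: (@leq_trans ((\sum_(j < i) u j * 4 ^ (i - j.+1)) * 4 + 4)%N).
  by rewrite ltn_add2l ltn_ord.
by rewrite addnC -mulSn leq_mul2r IHi.
Qed.

Definition omega (u : nat -> 'I_4) (s : orientations) : nat -> letter :=
  fun i => (u i, s i (Ordinal (base4_prefix_lt u i))).

Definition koch_curve (R : realType) (p : R) (s : orientations) :
    set (plane R) :=
  [set coding p (omega u s) | u in [set: nat -> 'I_4]].

Definition base4_expansions (R : realType) (t : R) : set (nat -> 'I_4) :=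
  [set u | series (fun i => (u i)%:R * (4 ^+ i.+1)^-1 : R) @ \oo --> t].

(** An arbitrary base 4 expansion of [t] is chosen; every [t] in [[0, 1]] has
    one, and the value does not depend on the choice. *)
Definition rho (R : realType) (p : R) (s : orientations) (t : R) : plane R :=
  coding p (omega (xget (fun=> ord0) (base4_expansions t)) s).

Definition f1 {R : realType} (z : plane R) : plane R :=
  let: (x, y) := z in
  (- (1 / 2) * x + Num.sqrt 3 / 2 * y + 1 / 4,
   - (Num.sqrt 3 / 2) * x - 1 / 2 * y - Num.sqrt 3 / 4).

Definition f2 {R : realType} (z : plane R) : plane R :=
  let: (x, y) := z in
  (- (1 / 2) * x - Num.sqrt 3 / 2 * y - 1 / 4,
   Num.sqrt 3 / 2 * x - 1 / 2 * y - Num.sqrt 3 / 4).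

Definition koch_snowflake (R : realType) (p : R) (s t r : orientations) :
    set (plane R) :=
  koch_curve p s `|` f1 @` koch_curve p t `|` f2 @` koch_curve p r.

(** Meaningful for [x] in [[0, 1]] only. *)
Definition snowflake_param (R : realType) (p : R) (s t r : orientations)
    (x : R) : plane R :=
  if x < 1 / 3 then rho p s (1 - 3 * x)
  else if x < 2 / 3 then f2 (rho p r (2 - 3 * x))
  else f1 (rho p t (3 - 3 * x)).

(* Main.v *)
Require Import Defs.
From mathcomp Require Import all_boot all_order all_algebra.
From mathcomp Require Import all_classical all_reals all_analysis.
From mathcomp Require Import ring lra zify.

Set Implicit Arguments.
Unset Strict Implicit.
Unset Printing Implicit Defensive.

Import Order.TTheory GRing.Theory Num.Theory.
Import numFieldNormedType.Exports.

Local Open Scope classical_set_scope.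
Local Open Scope ring_scope.

(** A generalised Koch curve consists of four copies, scaled by [p], of curves
    of the same kind. Take two points [x] and [y] of it. As long as both lie in
    the same quarter, the similitude that maps the whole curve to that quarter
    may be undone: it multiplies the distance of the points and the diameter of
    a joining set by the same factor. After finitely many steps the points lie
    in two different quarters. If these are not consecutive, the points are at
    distance at least [1/6], and the whole curve joins them. If they are
    consecutive, everything happens near the joint, which is the subject of
    [linked_arms].

    At each joint of two consecutive quarters, and at each corner of the
    snowflake, two arms start that are related by a reflection: up to a
    similitude they are a curve [K] and the mirror image of a curve [K'], both
    ending at the right vertex of the rhombus, and the mirror is a line through
    that vertex. The last quarters of both arms form the same picture scaled by
    [p] about the vertex. So it is enough that points of the two arms that are
    not both in the last quarters stay at a distance bounded from below, for
    the arms and for all their scaled versions ([arms_apart]): then points of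
    the two arms that separate at the [n]-th scale have a distance of at
    least the order of [p ^ n], and the [n]-th last quarters, joined at the vertex, form a
    connected set of that size.

    The lower bound is elementary. The rhombus lies on one side of the mirror.
    If it meets the mirror at the vertex only, the three other quarters are at a
    positive distance from the mirror ([arms_apart_wide]). This is always so at
    the joints on the axis, and at the apex of a bump and at the corners of the
    snowflake it is so for [p < 1/3]. For [p = 1/3] an edge of the rhombus lies
    on the mirror. Then the bump of an arm, if it points towards the mirror,
    touches it, but only at the far end of that edge, the tip of the bump, while
    the last quarter occupies the third of the edge next to the vertex. So the
    bound can fail only if the bumps of both arms point towards the mirror
    ([arms_apart_tight]); in that case both arms contain the same tip.

    Injectivity of the parameterisation excludes this. The common tip would be
    a value at two parameters with different base 4 expansions that do not end
    in a carry, hence at two different parameters of [[0, 1)]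
    ([codes_apart_apices] and [sides_apart_corner]). *)

(** * Euclidean distance and sets joining two points *)

Section EuclideanPlane.
Variable R : realType.
Implicit Types (x y z : plane R) (c C : R).

Definition edist x y : R := enorm (x - y).

Lemma edistE x y : edist x y = Num.sqrt ((x.1 - y.1) ^+ 2 + (x.2 - y.2) ^+ 2).
Proof. by []. Qed.

Lemma edist_ge0 x y : 0 <= edist x y.
Proof. exact: sqrtr_ge0. Qed.

Lemma sqr_edist x y : edist x y ^+ 2 = (x.1 - y.1) ^+ 2 + (x.2 - y.2) ^+ 2.
Proof. by rewrite edistE sqr_sqrtr // addr_ge0 ?sqr_ge0. Qed.

Lemma edistC x y : edist x y = edist y x.
Proof. by rewrite !edistE; congr Num.sqrt; ring. Qed.

Lemma edistxx x : edist x x = 0.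
Proof. by rewrite edistE !subrr expr0n addr0 sqrtr0. Qed.

Lemma ler_edist1 x y : `|x.1 - y.1| <= edist x y.
Proof.
rewrite -(ler_pXn2r (n := 2)) ?nnegrE ?edist_ge0 // sqr_edist real_normK ?num_real //.
by rewrite lerDl sqr_ge0.
Qed.

Lemma ler_edist2 x y : `|x.2 - y.2| <= edist x y.
Proof.
rewrite -(ler_pXn2r (n := 2)) ?nnegrE ?edist_ge0 // sqr_edist real_normK ?num_real //.
by rewrite lerDr sqr_ge0.
Qed.

Lemma edist_le x y : edist x y <= `|x.1 - y.1| + `|x.2 - y.2|.
Proof.
rewrite -(ler_pXn2r (n := 2)) ?nnegrE ?edist_ge0 ?addr_ge0 // sqr_edist.
rewrite [leRHS]sqrrD !real_normK ?num_real // -addrA lerD2l lerDr.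
by rewrite mulrn_wge0 // mulr_ge0.
Qed.

Lemma edist_eq0 x y : edist x y = 0 -> x = y.
Proof.
move=> d0; have := ler_edist1 x y; have := ler_edist2 x y.
rewrite d0 !normr_le0 !subr_eq0 => /eqP e2 /eqP e1.
by rewrite (surjective_pairing x) e1 e2 -surjective_pairing.
Qed.

Lemma edist_triangle y x z : edist x z <= edist x y + edist y z.
Proof.
rewrite -(ler_pXn2r (n := 2)) ?nnegrE ?edist_ge0 ?addr_ge0 ?edist_ge0 //.
rewrite [leRHS]sqrrD !sqr_edist -[_ *+ 2]mulr_natl.
have ex : x.1 - z.1 = (x.1 - y.1) + (y.1 - z.1) by ring.
have ey : x.2 - z.2 = (x.2 - y.2) + (y.2 - z.2) by ring.
rewrite {}ex {}ey.
have := mulr_ge0 (edist_ge0 x y) (edist_ge0 y z).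
have : (edist x y * edist y z) ^+ 2 =
    ((x.1 - y.1) ^+ 2 + (x.2 - y.2) ^+ 2) *
    ((y.1 - z.1) ^+ 2 + (y.2 - z.2) ^+ 2) by rewrite exprMn !sqr_edist.
move: (edist x y * edist y z) => E.
move: (x.1 - y.1) (x.2 - y.2) (y.1 - z.1) (y.2 - z.2) => a b c d hE E0.
suff h : a * c + b * d <= E.
  rewrite [leLHS](_ : _ = a ^+ 2 + b ^+ 2 + 2 * (a * c + b * d) +
    (c ^+ 2 + d ^+ 2)); last by ring.
  by rewrite lerD2r lerD2l ler_wpM2l.
apply: le_trans (ler_norm _) _.
rewrite -(ler_pXn2r (n := 2)) ?nnegrE // real_normK ?num_real // hE -subr_ge0.
rewrite (_ : _ - _ = (a * d - b * c) ^+ 2); last by ring.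
exact: sqr_ge0.
Qed.

Lemma nbhs_edist z (U : set (plane R)) :
  nbhs z U -> exists2 e, 0 < e & forall x, edist x z < e -> U x.
Proof.
move=> /nbhs_ballP [e /= e0 sU]; exists e => // x xz; apply: sU.
split; rewrite -ball_normE /ball_ /= distrC; apply: le_lt_trans xz.
  exact: ler_edist1.
exact: ler_edist2.
Qed.

Definition similarity c (T : plane R -> plane R) :=
  forall x y, edist (T x) (T y) = c * edist x y.

Lemma similarity_sqr c (T : plane R -> plane R) : 0 <= c ->
  (forall x y, ((T x).1 - (T y).1) ^+ 2 + ((T x).2 - (T y).2) ^+ 2 =
    c ^+ 2 * ((x.1 - y.1) ^+ 2 + (x.2 - y.2) ^+ 2)) ->
  similarity c T.
Proof.
move=> c0 h x y; rewrite !edistE h sqrtrM ?sqr_ge0 //.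
by rewrite sqrtr_sqr ger0_norm.
Qed.

Lemma similarity_continuous c (T : plane R -> plane R) :
  similarity c T -> continuous T.
Proof.
move=> sT z U /nbhs_edist [e e0 sU].
have c0 : 0 < 2 * (`|c| + 1) by rewrite mulr_gt0 // ltr_wpDl.
apply/nbhs_ballP; exists (e / (2 * (`|c| + 1))); first by rewrite /= divr_gt0.
move=> x [] /=; rewrite -!ball_normE /ball_ /= => h1 h2; apply: sU.
have h : edist z x < e / (`|c| + 1).
  apply: le_lt_trans (edist_le _ _) _.
  apply: lt_le_trans (ltrD h1 h2) _.
  by rewrite le_eqVlt; apply/orP; left; apply/eqP; field; rewrite gt_eqF // ltr_wpDl.
rewrite edistC sT; apply: le_lt_trans (_ : (`|c| + 1) * edist z x < e).
  apply: ler_wpM2r; first exact: edist_ge0.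
  by apply: le_trans (ler_norm _) _; rewrite lerDl.
by rewrite mulrC -ltr_pdivlMr // ltr_wpDl.
Qed.

(** Bounded turning for a single pair of points; unlike the property of the
    whole set, it can be moved by similitudes and proved pair by pair. *)
Definition linked C (F : set (plane R)) x y :=
  exists G : set (plane R),
    [/\ G `<=` F, compact G /\ connected G, G x, G y &
        forall u v, G u -> G v -> edist u v <= C * edist x y].

Lemma linked_sub C D (F F' : set (plane R)) x y :
  C <= D -> F `<=` F' -> linked C F x y -> linked D F' x y.
Proof.
move=> CD FF [G [GF GT Gx Gy Gd]]; exists G; split => //.
  exact: subset_trans FF.
move=> u v Gu Gv; apply: le_trans (Gd _ _ Gu Gv) _.
by apply: ler_wpM2r; first exact: edist_ge0.
Qed.

Lemma linked_sym C (F : set (plane R)) x y : linked C F x y -> linked C F y x.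
Proof.
move=> [G [GF GT Gx Gy Gd]]; exists G; split => // u v Gu Gv.
by rewrite (edistC y); exact: Gd.
Qed.

Lemma linked_refl C (F : set (plane R)) x : F x -> linked C F x x.
Proof.
move=> Fx; exists [set x]; split => //.
- by move=> _ ->.
- by split; [exact: compact_set1|exact: connected1].
- by move=> u v -> ->; rewrite edistxx mulr0.
Qed.

Lemma linked_image c C (T : plane R -> plane R) (F : set (plane R)) x y :
  0 <= c -> similarity c T -> linked C F x y ->
  linked C (T @` F) (T x) (T y).
Proof.
move=> c0 sT [G [GF [Gk Gc] Gx Gy Gd]].
have cT : {within G, continuous T}.
  by apply: continuous_subspaceT; exact: similarity_continuous sT.
exists (T @` G); split.
- exact: image_subset.
- by split; [exact: continuous_compact|exact: connected_continuous_connected].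
- by exists x.
- by exists y.
- move=> _ _ [u Gu <-] [v Gv <-]; rewrite !sT mulrCA.
  by apply: ler_wpM2l => //; exact: Gd.
Qed.

Lemma linked_bounded_turning C (F : set (plane R)) :
  (forall x y, F x -> F y -> linked C F x y) -> bounded_turning F.
Proof.
move=> h; exists (Num.max 1 C); first by rewrite le_max lexx.
move=> x y Fx Fy; have [G [GF GT Gx Gy Gd]] := h _ _ Fx Fy.
exists G; split => //; apply: ge_ereal_sup => _ [[u v] [/= Gu Gv] <-].
rewrite lee_fin; apply: le_trans (Gd _ _ Gu Gv) _.
by apply: ler_wpM2r; [exact: edist_ge0|rewrite le_max lexx orbT].
Qed.

End EuclideanPlane.

(** * The similitudes, the rhombus and the coding map *)

Section Similitudes.
Variables (R : realType) (p : R).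
Hypothesis hp : 1 / 4 < p <= 1 / 3.
Local Notation q := (qpar p).

Lemma p_gt0 : 0 < p. Proof. by move: hp => /andP[h _]; lra. Qed.

Lemma q_gt0 : 0 < q.
Proof. by rewrite sqrtr_gt0; move: hp => /andP[h _]; lra. Qed.

Lemma sqr_q : q * q = 4 * p - 1.
Proof. by rewrite -expr2 sqr_sqrtr //; move: hp => /andP[h _]; lra. Qed.

Lemma q_le1 : q <= 1.
Proof. by have := sqr_q; have := q_gt0; move: hp => /andP[_ h]; nra. Qed.

(** [1] if the bump of the two middle quarters points up and [-1] if it points
    down, so that one formula serves both cases. *)
Definition bump_sign (b : 'I_2) : R := (-1) ^+ b.

Lemma bump_signP b : bump_sign b = 1 \/ bump_sign b = -1.
Proof. by case: b => [[|[|]] //= ?]; rewrite /bump_sign /= ?expr1; [left|right]. Qed.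

(** Measured in units of [q], ordinates transform with coefficients in which [q]
    occurs only through [q ^ 2 = 4 p - 1], and the rhombus becomes the diamond
    [|x| + |Y| <= 1/2]. All later estimates are linear in [x] and [Y]. *)
Lemma phiE a (x Y : R) : phi p a (x, q * Y) =
  match val a.1 with
  | 0%N => (p * x - (1 - p) / 2, q * (p * Y))
  | 1%N => (((1 - 2 * p) * x - bump_sign a.2 * (4 * p - 1) * Y) / 2 + (2 * p - 1) / 4,
            q * ((bump_sign a.2 * x + (1 - 2 * p) * Y) / 2 + bump_sign a.2 / 4))
  | 2%N => (((1 - 2 * p) * x + bump_sign a.2 * (4 * p - 1) * Y) / 2 + (1 - 2 * p) / 4,
            q * ((- bump_sign a.2 * x + (1 - 2 * p) * Y) / 2 + bump_sign a.2 / 4))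
  | _ => (p * x + (1 - p) / 2, q * (p * Y))
  end.
Proof.
rewrite /phi -sqr_q /bump_sign;
  case: a => [[[|[|[|[|]]]] // ?] [[|[|]] // ?]] /=; congr pair;
  by rewrite ?expr0 ?expr1; field.
Qed.

Lemma stretchE (y : R) : exists Y : R, y = q * Y.
Proof. by exists (y / q); field; rewrite gt_eqF // q_gt0. Qed.

Lemma phi_similarity a : similarity p (phi p a).
Proof.
apply: similarity_sqr; first exact: ltW p_gt0.
move=> [x1 y1] [x2 y2]; have [Y1 ->] := stretchE y1; have [Y2 ->] := stretchE y2.
rewrite !phiE /=.
have hq := sqr_q.
have hqE (u v : R) : (q * u - q * v) ^+ 2 = (4 * p - 1) * (u - v) ^+ 2.
  by rewrite -hq; ring.
case: a => [[[|[|[|[|]]]] // ?] b] /=; rewrite ?hqE;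
  case: (bump_signP b) => e; rewrite ?e; by field.
Qed.

Definition diamond (x Y : R) :=
  [/\ x + Y <= 1 / 2, x - Y <= 1 / 2, - x + Y <= 1 / 2 & - x - Y <= 1 / 2].

(** The images of points of the diamond satisfy inequalities that are linear in
    the point but have coefficients in [p]; they follow linearly from the sides
    of the diamond multiplied by [p - 1/4] and by [1/3 - p]. *)
Lemma diamond_scale (c x Y : R) : 0 <= c -> diamond x Y ->
  [/\ c * (x + Y) <= c * (1 / 2), c * (x - Y) <= c * (1 / 2),
      c * (- x + Y) <= c * (1 / 2) & c * (- x - Y) <= c * (1 / 2)].
Proof. by move=> c0 [h1 h2 h3 h4]; split; exact: ler_wpM2l. Qed.

Lemma diamond_phi a (x Y : R) : diamond x Y ->
  exists X' Y', phi p a (x, q * Y) = (X', q * Y') /\ diamond X' Y'.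
Proof.
move=> dY; have [h1 h2 h3 h4] := dY; rewrite phiE; move: (hp) => /andP[p1 p2].
have [p1' p2'] : 0 <= p - 1 / 4 /\ 0 <= 1 / 3 - p by split; lra.
have [a1 a2 a3 a4] := diamond_scale p1' dY.
have [b1 b2 b3 b4] := diamond_scale p2' dY.
case: a => [[[|[|[|[|]]]] // ?] b] /=; do 2!eexists; (split; [reflexivity|]);
  case: (bump_signP b) => e; rewrite ?e; split; lra.
Qed.

Lemma closed_half (a b c : R) :
  closed [set z : plane R | a * z.1 + b * z.2 <= c].
Proof.
apply: (@closed_comp _ _ (fun z : plane R => a * z.1 + b * z.2) [set y | y <= c]);
  last exact: closed_le.
move=> z _; apply: (@cvgD _ R^o); apply: (@cvgM R); try exact: cvg_cst.
  exact: cvg_fst.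
exact: cvg_snd.
Qed.

Lemma convex_half (a b c : R) :
  convex_set ([set z : plane R | a * z.1 + b * z.2 <= c] :
    set (convex_lmodType (plane R))).
Proof.
move=> x y l; rewrite !inE /= => hx hy.
have l0 : 0 <= l%:num by [].
have l1 : l%:num <= 1 by [].
have l1' : 0 <= 1 - l%:num by rewrite subr_ge0.
have := lerD (ler_wpM2l l0 hx) (ler_wpM2l l1' hy).
rewrite (_ : l%:num * c + (1 - l%:num) * c = c); last by ring.
apply: le_trans; rewrite le_eqVlt; apply/orP; left; apply/eqP.
transitivity (a * (l%:num * x.1 + (1 - l%:num) * y.1) +
  b * (l%:num * x.2 + (1 - l%:num) * y.2)); [by []|ring].
Qed.

Lemma rhombus_coords (z : plane R) : rhombus p z <->
  exists x Y, z = (x, q * Y) /\ diamond x Y.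
Proof.
have q0 := q_gt0.
split.
  move=> Vz; have [Y zY] := stretchE z.2; exists z.1, Y; split.
    by rewrite -zY -surjective_pairing.
  have side (a b : R) : (a = 1 \/ a = -1) -> (b = 1 \/ b = -1) ->
      a * q * z.1 + b * z.2 <= q / 2.
    move=> a1 b1; apply: (Vz [set z : plane R | a * q * z.1 + b * z.2 <= q / 2]).
    split; first by split; [exact: closed_half|exact: convex_half].
    move=> y /=; rewrite !inE => /or4P[] /eqP -> /=;
      by case: a1 => ->; case: b1 => ->; lra.
  have h a b (a1 : a = 1 \/ a = -1) (b1 : b = 1 \/ b = -1) : a * z.1 + b * Y <= 1 / 2.
    rewrite -(ler_pM2l q0); have := side a b a1 b1; rewrite zY.
    by move=> h; apply: le_trans (_ : _ <= q / 2) _; last lra; rewrite (le_trans _ h) //; lra.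
  have r1 := h 1 1 (or_introl erefl) (or_introl erefl).
  have r2 := h 1 (-1) (or_introl erefl) (or_intror erefl).
  have r3 := h (-1) 1 (or_intror erefl) (or_introl erefl).
  have r4 := h (-1) (-1) (or_intror erefl) (or_intror erefl).
  split; lra.
move=> [x [Y [-> [d1 d2 d3 d4]]]] A [[_ cA] sA].
have vertex (v : plane R) : v \in [:: (- (1 / 2), 0); (1 / 2, 0);
    (0, - (q / 2)); (0, q / 2)] -> (v : convex_lmodType (plane R)) \in A.
  by move=> hv; rewrite in_setE; exact: sA.
have conv01 (u v w : plane R) (l : R) : u \in A -> v \in A -> 0 <= l <= 1 ->
    l * u.1 + (1 - l) * v.1 = w.1 -> l * u.2 + (1 - l) * v.2 = w.2 -> w \in A.
  move=> Au Av /andP[l0 l1] e1 e2; rewrite (surjective_pairing w) -e1 -e2.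
  exact: (cA u v (@Itv01 R l l0 l1)).
(* the point lies on a horizontal chord joining two edges of the rhombus *)
have chord e : e = 1 \/ e = -1 -> 0 <= e * Y ->
    forall f : R, f = 1 \/ f = -1 -> ((f * (1 / 2 - e * Y), q * Y) : plane R) \in A.
  move=> e1 eY f f1.
  apply: (conv01 (0, e * (q / 2)) (f * (1 / 2), 0) _ (2 * (e * Y))) => /=.
  - by apply: vertex; case: e1 => ->; rewrite !inE ?mul1r ?mulN1r eqxx ?orbT.
  - by apply: vertex; case: f1 => ->; rewrite !inE ?mul1r ?mulN1r eqxx ?orbT.
  - by case: e1 eY => -> ?; apply/andP; split; lra.
  - by field.
  - by case: e1 => ->; field.
have [e e1 eY] : exists2 e : R, e = 1 \/ e = -1 & 0 <= e * Y.
  have [Y0|Y0] := leP 0 Y; first by exists 1; [left|rewrite mul1r].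
  by exists (-1); [right|rewrite mulN1r oppr_ge0 ltW].
have c1 := chord e e1 eY 1 (or_introl erefl).
have c2 := chord e e1 eY (-1) (or_intror erefl).
have [a0|a0] := eqVneq (1 / 2 - e * Y) 0.
  have -> : x = 1 * (1 / 2 - e * Y) by rewrite a0; case: e1 a0 => ->; lra.
  by rewrite -in_setE.
have a1 : 0 < 1 / 2 - e * Y.
  by rewrite lt_neqAle eq_sym a0 /=; case: e1 => ->; lra.
rewrite -in_setE.
apply: (conv01 _ _ _ ((x + (1 / 2 - e * Y)) / (2 * (1 / 2 - e * Y))) c1 c2) => /=.
- apply/andP; split; first by rewrite divr_ge0 //; case: e1 => ->; lra.
  by rewrite ler_pdivrMr ?mulr_gt0 //; case: e1 => ->; lra.
- by move: a0; move: (1 / 2 - e * Y) => a a0 /=; field.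
- by move: a0; move: (1 / 2 - e * Y) => a a0 /=; field.
Qed.

Lemma rhombus_phi a z : rhombus p z -> rhombus p (phi p a z).
Proof.
move=> /rhombus_coords [x [Y [-> dY]]]; apply/rhombus_coords.
have [x' [Y' [-> d']]] := diamond_phi a dY.
by exists x', Y'.
Qed.

(** A bounded set that contains the rhombus and is visibly invariant under
    reflections. *)
Definition in_box (z : plane R) := `|z.1| <= 1 /\ `|z.2| <= 1.

Lemma rhombus_box z : rhombus p z -> in_box z.
Proof.
move=> /rhombus_coords [x [Y [-> [d1 d2 d3 d4]]]]; have := q_gt0; have := q_le1.
move=> q1 q0; split => /=; first by rewrite ler_norml; apply/andP; split; lra.
rewrite normrM (gtr0_norm q0).
have : `|Y| <= 1 by rewrite ler_norml; apply/andP; split; lra.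
by have := normr_ge0 Y; nra.
Qed.

Lemma box_edist z z' : in_box z -> in_box z' -> edist z z' <= 4.
Proof.
move=> [a b] [c d]; apply: le_trans (edist_le _ _) _.
by have := ler_normB z.1 z'.1; have := ler_normB z.2 z'.2; lra.
Qed.

Lemma rhombus_closed : closed (rhombus p).
Proof.
apply: closed_bigI => A [[cA _] _]; exact: cA.
Qed.

Lemma rhombus_compact : compact (rhombus p).
Proof.
apply: (subclosed_compact rhombus_closed
  (compact_setX (@segment_compact R (-1) 1) (@segment_compact R (-1) 1))).
by move=> z /rhombus_box [z1 z2]; split => /=; rewrite in_itv /= -ler_norml.
Qed.

Lemma phi_wordS (w : nat -> letter) k z :
  phi_word p w k.+1 z = phi p (w 0%N) (phi_word p (fun i => w i.+1) k z).
Proof. by rewrite /phi_word big_ord_recl. Qed.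

Lemma phi_wordSr (w : nat -> letter) k z :
  phi_word p w k.+1 z = phi_word p w k (phi p (w k) z).
Proof.
elim: k w z => [|k IH] w z; first by rewrite phi_wordS /phi_word !big_ord0.
by rewrite phi_wordS IH -phi_wordS.
Qed.

Lemma phi_word_similarity (w : nat -> letter) k : similarity (p ^+ k) (phi_word p w k).
Proof.
elim: k w => [|k IH] w x y; first by rewrite /phi_word !big_ord0 mul1r.
by rewrite !phi_wordS phi_similarity IH mulrA -exprS.
Qed.

Lemma phi_word_rhombus w k z : rhombus p z -> rhombus p (phi_word p w k z).
Proof.
elim: k w => [|k IH] w Vz; first by rewrite /phi_word big_ord0.
by rewrite phi_wordS; apply: rhombus_phi; exact: IH.
Qed.

Lemma phi_word_nested (w : nat -> letter) k m z : rhombus p z ->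
  (phi_word p w k @` rhombus p) (phi_word p w (k + m) z).
Proof.
elim: m z => [|m IH] z Vz; first by rewrite addn0; exists z => //.
by rewrite addnS phi_wordSr; apply: IH; exact: rhombus_phi.
Qed.

Lemma rhombus0 : rhombus p (0 : plane R).
Proof.
apply/rhombus_coords; exists 0, 0; rewrite mulr0; split => //; split; lra.
Qed.

(** The images of the rhombus are nested compact sets, so a cluster point of the
    successive images of a single point lies in all of them. *)
Lemma codingP (w : nat -> letter) k : (phi_word p w k @` rhombus p) (coding p w).
Proof.
suff [z hz] : exists z, (\bigcap_k (phi_word p w k.+1 @` rhombus p)) z.
  have h : (\bigcap_k (phi_word p w k.+1 @` rhombus p)) (coding p w) by exact: (xgetI 0 hz).
  have [v Vv e] := h k I.
  by exists (phi p (w k) v); [exact: rhombus_phi|rewrite -phi_wordSr].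
pose u k := phi_word p w k 0.
have [|z [Vz cz]] := rhombus_compact (F := u @ \oo).
  by exists 0%N => // n _; apply: phi_word_rhombus; exact: rhombus0.
exists z => n _.
have cl : closed (phi_word p w n.+1 @` rhombus p).
  apply: compact_closed; first exact: norm_hausdorff.
  apply: continuous_compact rhombus_compact.
  by apply: continuous_subspaceT; apply: similarity_continuous (phi_word_similarity _ _).
rewrite clusterE in cz; move: cl => /closure_id ->; apply: cz.
exists n.+1 => // m /= nm; rewrite -(subnKC nm).
apply: phi_word_nested; exact: rhombus0.
Qed.

Lemma coding_rhombus w : rhombus p (coding p w).
Proof. by have [v Vv <-] := codingP w 0; rewrite /phi_word big_ord0. Qed.

Lemma lt_exp_p (d : R) : 0 < d -> exists n : nat, 4 * p ^+ n < d.
Proof.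
move=> d0; have p0 := p_gt0.
have : (p ^+ n @[n --> \oo] --> 0).
  by apply: cvg_expr; rewrite gtr0_norm //; move: hp => /andP[_]; lra.
move=> /cvgrPdist_lt /(_ (d / 4)) [|N _ h]; first by rewrite divr_gt0.
exists N; have := h N (leqnn N); rewrite sub0r normrN ger0_norm ?exprn_ge0 ?(ltW p0) //.
by lra.
Qed.

(** Images of bounded sets under long words are small, so it does not matter that
    the points [v] are only known to lie in the box. *)
Lemma coding_unique (w : nat -> letter) z :
  (forall k, exists2 v, in_box v & phi_word p w k v = z) -> coding p w = z.
Proof.
move=> h; apply: edist_eq0; apply/eqP/negP => /negP d0.
have /lt_exp_p [n hn] : 0 < edist (coding p w) z by rewrite lt_neqAle eq_sym d0 edist_ge0.
have [v hv zv] := h n; have [v' /rhombus_box hv' zv'] := codingP w n.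
move: hn; rewrite -{1}zv -{1}zv' phi_word_similarity ltNge => /negP; apply.
rewrite mulrC; apply: ler_wpM2r; last exact: box_edist.
by rewrite exprn_ge0 // ltW // p_gt0.
Qed.

Lemma codingS (w : nat -> letter) :
  coding p w = phi p (w 0%N) (coding p (fun i => w i.+1)).
Proof.
apply: coding_unique => -[|k].
  exists (phi p (w 0%N) (coding p (fun i => w i.+1))); last by rewrite /phi_word big_ord0.
  by apply: rhombus_box; apply: rhombus_phi; exact: coding_rhombus.
have [v Vv e] := codingP (fun i => w i.+1) k.
by exists v; [exact: rhombus_box|rewrite phi_wordS e].
Qed.

Lemma coding_fixed (w : nat -> letter) z :
  rhombus p z -> (forall i, phi p (w i) z = z) -> coding p w = z.
Proof.
move=> Vz fixz; apply: coding_unique => k; exists z; first exact: rhombus_box.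
by elim: k => [|k IH]; [rewrite /phi_word big_ord0|rewrite phi_wordSr fixz].
Qed.

(** How symmetries of the family of similitudes act on codes. *)
Lemma coding_equivariant (T : plane R -> plane R) (tau : letter -> letter) w :
  (forall z, in_box z -> in_box (T z)) ->
  (forall a z, T (phi p a z) = phi p (tau a) (T z)) ->
  T (coding p w) = coding p (tau \o w).
Proof.
move=> Tb Tphi; symmetry; apply: coding_unique => k.
have [v /rhombus_box hv <-] := codingP w k; exists (T v); first exact: Tb.
elim: k w {hv} => [|k IH] w; first by rewrite /phi_word !big_ord0.
by rewrite !phi_wordS Tphi -IH.
Qed.

End Similitudes.

(** * Trees of orientations *)

(** The choices of bumps as a function on finite words. In this form the choices
    inside a quarter of the curve are again such a function, [subtree o [:: d]],
    and all statements about curves can be proved for all trees at once. *)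
Definition tree := seq 'I_4 -> 'I_2.

Definition subtree (o : tree) (w : seq 'I_4) : tree := fun v => o (w ++ v).

Definition address (u : nat -> 'I_4) (o : tree) : nat -> letter :=
  fun i => (u i, o (mkseq u i)).

Definition scons T (d : T) (u : nat -> T) : nat -> T :=
  fun i => if i is i'.+1 then u i' else d.

(** The choices for the curve seen in the mirror [x -> - x], which runs through
    its quarters in the opposite order. *)
Definition revtree (o : tree) : tree := fun w => o (map (@rev_ord 4) w).

Lemma subtree_cat o w v : subtree o (w ++ v) = subtree (subtree o w) v.
Proof. by apply/funext => x; rewrite /subtree catA. Qed.

Lemma subtree_rcons o w d : subtree o (rcons w d) = subtree (subtree o w) [:: d].
Proof. by rewrite -cats1 subtree_cat. Qed.

Lemma revtreeK : involutive revtree.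
Proof.
move=> o; apply/funext => w; rewrite /revtree -map_comp map_id_in // => d _ /=.
by rewrite rev_ordK.
Qed.

Lemma subtree_revtree o w :
  subtree (revtree o) w = revtree (subtree o (map (@rev_ord 4) w)).
Proof. by apply/funext => v; rewrite /subtree /revtree map_cat. Qed.

Lemma mkseqSl T (u : nat -> T) n : mkseq u n.+1 = u 0%N :: mkseq (fun i => u i.+1) n.
Proof. by rewrite /mkseq /= -add1n iotaDl -map_comp. Qed.

Lemma address_tail u o :
  (fun i => address u o i.+1) = address (fun i => u i.+1) (subtree o [:: u 0%N]).
Proof. by apply/funext => i; rewrite /address mkseqSl. Qed.

Lemma address_rev u o :
  (fun a : letter => (rev_ord a.1, a.2)) \o address u o =
  address (@rev_ord 4 \o u) (revtree o).
Proof.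
apply/funext => i; rewrite /address /revtree /=; congr (_, o _).
by rewrite /mkseq -map_comp; apply: eq_map => j /=; rewrite rev_ordK.
Qed.

(** Repeated subdivision; both the compactness and the connectedness of the
    curves are obtained by following a property down to ever smaller pieces. *)
Lemma infinite_branch (P : seq 'I_4 -> Prop) :
  P [::] -> (forall w, P w -> exists d, P (rcons w d)) ->
  exists u, forall n, P (mkseq u n).
Proof.
move=> P0 PS.
have PS' w : exists d, P w -> P (rcons w d).
  have [/PS [d hd]|nP] := pselect (P w); first by exists d.
  by exists ord0.
have [f hf] := choice PS'.
pose W := fix W n := if n is n'.+1 then rcons (W n') (f (W n')) else [::].
exists (f \o W); have WE n : mkseq (f \o W) n = W n.
  by elim: n => // n IH; rewrite mkseqS IH.
by move=> n; rewrite WE; elim: n => //= n IH; apply: hf.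
Qed.

(** * The curves and their pieces *)

Section Curves.
Variables (R : realType) (p : R).
Hypothesis hp : 1 / 4 < p <= 1 / 3.
Local Notation q := (qpar p).

Definition curve (o : tree) : set (plane R) :=
  [set coding p (address u o) | u in [set: nat -> 'I_4]].

Definition Pleft : plane R := (- (1 / 2) : R, 0 : R).
Definition Pright : plane R := (1 / 2 : R, 0 : R).

Definition flip (z : plane R) : plane R := (- z.1 : R, z.2 : R).

Lemma PleftE : Pleft = (- (1 / 2) : R, q * 0 : R).
Proof. by rewrite mulr0. Qed.

Lemma PrightE : Pright = (1 / 2 : R, q * 0 : R).
Proof. by rewrite mulr0. Qed.

Lemma coding_address u o : coding p (address u o) =
  phi p (u 0%N, o [::]) (coding p (address (fun i => u i.+1) (subtree o [:: u 0%N]))).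
Proof. by rewrite (codingS hp) address_tail. Qed.

Lemma coding_address_scons d u o : coding p (address (scons d u) o) =
  phi p (d, o [::]) (coding p (address u (subtree o [:: d]))).
Proof. by rewrite coding_address. Qed.

Lemma curve_rhombus o z : curve o z -> rhombus p z.
Proof. by move=> [u _ <-]; exact: coding_rhombus. Qed.

Lemma curve_edist o x y : curve o x -> curve o y -> edist x y <= 4.
Proof.
by move=> /curve_rhombus/(rhombus_box hp) bx /curve_rhombus/(rhombus_box hp);
  exact: box_edist.
Qed.

Lemma curve_phi o d z :
  curve (subtree o [:: d]) z -> curve o (phi p (d, o [::]) z).
Proof. by move=> [u _ <-]; exists (scons d u); rewrite ?coding_address_scons. Qed.

Lemma curve_split o z : curve o z ->
  exists d z', curve (subtree o [:: d]) z' /\ z = phi p (d, o [::]) z'.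
Proof.
by move=> [u _ <-]; rewrite coding_address; do 2!eexists; split; [eexists|].
Qed.

Lemma phi_Pleft b : phi p (ord0, b) Pleft = Pleft.
Proof. by rewrite PleftE phiE //=; congr (_, q * _); field. Qed.

Lemma phi_Pright b : phi p (ord_max, b) Pright = Pright.
Proof. by rewrite PrightE phiE //=; congr (_, q * _); field. Qed.

Lemma phi_joint (d d' : 'I_4) b : val d' = (val d).+1 ->
  phi p (d, b) Pright = phi p (d', b) Pleft.
Proof.
rewrite PrightE PleftE !phiE //=.
case: d => [[|[|[|[|]]]] // ?] /=; case: d' => [[|[|[|[|]]]] // ?] //= _;
  case: (bump_signP R b) => e; rewrite ?e; congr (_, q * _); by field.
Qed.

Lemma coding_const d o z : rhombus p z -> (forall b, phi p (d, b) z = z) ->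
  coding p (address (fun=> d) o) = z.
Proof. by move=> Vz dz; apply: coding_fixed => // i; exact: dz. Qed.

Lemma rhombus_Pleft : rhombus p Pleft.
Proof.
apply/(rhombus_coords hp); exists (- (1 / 2)), 0; rewrite mulr0; split => //.
by split; lra.
Qed.

Lemma rhombus_Pright : rhombus p Pright.
Proof.
apply/(rhombus_coords hp); exists (1 / 2), 0; rewrite mulr0; split => //.
by split; lra.
Qed.

Lemma coding_left o : coding p (address (fun=> ord0) o) = Pleft.
Proof. by apply: coding_const; [exact: rhombus_Pleft|exact: phi_Pleft]. Qed.

Lemma coding_right o : coding p (address (fun=> ord_max) o) = Pright.
Proof. by apply: coding_const; [exact: rhombus_Pright|exact: phi_Pright]. Qed.

Lemma curve_left o : curve o Pleft.
Proof. by exists (fun=> ord0); rewrite ?coding_left. Qed.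

Lemma curve_right o : curve o Pright.
Proof. by exists (fun=> ord_max); rewrite ?coding_right. Qed.

Lemma flipK : involutive flip.
Proof. by move=> [x y]; rewrite /flip /= opprK. Qed.

(** Reflection in the vertical axis exchanges the quarters [0] and [3] and the
    quarters [1] and [2], and keeps the bumps. *)
Lemma flip_phi (a : letter) z : flip (phi p a z) = phi p (rev_ord a.1, a.2) (flip z).
Proof.
case: z => x y; have [Y ->] := stretchE hp y;
rewrite (_ : flip (x, q * Y) = (- x : R, q * Y : R)) // !phiE // /flip /=.
case: a => [[[|[|[|[|]]]] // ?] b] /=; congr (_, q * _);
  case: (bump_signP R b) => e; rewrite ?e; by field.
Qed.

Lemma flip_coding u o :
  flip (coding p (address u o)) = coding p (address (@rev_ord 4 \o u) (revtree o)).
Proof.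
rewrite -address_rev; apply: (coding_equivariant hp) flip_phi => z [z1 z2].
by split => //=; rewrite normrN.
Qed.

Lemma curve_flip o z : curve o z -> curve (revtree o) (flip z).
Proof. by move=> [u _ <-]; rewrite flip_coding; eexists. Qed.

Fixpoint cylmap (o : tree) (w : seq 'I_4) (z : plane R) : plane R :=
  if w is d :: w' then phi p (d, o [::]) (cylmap (subtree o [:: d]) w' z) else z.

Lemma cylmap_cat o w v z : cylmap o (w ++ v) z = cylmap o w (cylmap (subtree o w) v z).
Proof.
by elim: w o => //= d w IH o; rewrite IH -subtree_cat.
Qed.

Lemma cylmap_rcons o w d z : cylmap o (rcons w d) z = cylmap o w (phi p (d, o w) z).
Proof. by rewrite -cats1 cylmap_cat /= /subtree cats0. Qed.

Lemma cylmap_similarity o w : similarity (p ^+ size w) (cylmap o w).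
Proof.
elim: w o => [|d w IH] o x y /=; first by rewrite mul1r.
by rewrite (phi_similarity hp) IH mulrA -exprS.
Qed.

Definition cyl o w : set (plane R) := cylmap o w @` curve (subtree o w).

Lemma cyl_split o w z : cyl o w z -> exists d, cyl o (rcons w d) z.
Proof.
move=> [y /curve_split [d [x [cx ->]] <-]]; exists d; exists x.
  by rewrite subtree_rcons.
by rewrite cylmap_rcons /subtree cats0.
Qed.

Lemma cyl_rcons o w d : cyl o (rcons w d) `<=` cyl o w.
Proof.
move=> _ [x cx <-]; exists (phi p (d, subtree o w [::]) x).
  by apply: curve_phi; rewrite -subtree_rcons.
by rewrite cylmap_rcons /subtree cats0.
Qed.

Lemma cyl_sub o w : cyl o w `<=` curve o.
Proof.
elim/last_ind: w => [|w d IH]; first by move=> _ [x cx <-].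
by apply: subset_trans IH; exact: cyl_rcons.
Qed.

Lemma coding_cyl u o n : cyl o (mkseq u n) (coding p (address u o)).
Proof.
elim: n u o => [|n IH] u o; first by exists (coding p (address u o)) => //; exists u.
rewrite mkseqSl coding_address.
have [z cz <-] := IH (fun i => u i.+1) (subtree o [:: u 0%N]).
by exists z => //; rewrite -cat1s subtree_cat.
Qed.

Lemma cyl_edist o w x y : cyl o w x -> cyl o w y -> edist x y <= 4 * p ^+ size w.
Proof.
move=> [x' cx <-] [y' cy <-]; rewrite cylmap_similarity mulrC.
apply: ler_wpM2r; last exact: curve_edist cx cy.
by rewrite exprn_ge0 // ltW // p_gt0.
Qed.

(** The cylinders along a branch shrink to the point that the branch codes. *)
Lemma cyl_nbhs u o (U : set (plane R)) : nbhs (coding p (address u o)) U ->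
  exists n, cyl o (mkseq u n) `<=` U.
Proof.
move=> /nbhs_edist [e e0 sU]; have [n hn] := lt_exp_p hp e0.
exists n => x cx; apply: sU; apply: le_lt_trans hn.
by have := cyl_edist cx (coding_cyl u o n); rewrite size_mkseq.
Qed.

(** An ultrafilter that contains a piece contains one of its four quarters;
    following these leads to the limit of the ultrafilter. *)
Lemma curve_compact o : compact (curve o).
Proof.
rewrite compact_ultra => F FU FA.
have [||u hu] := @infinite_branch (fun w => F (cyl o w)).
- by apply: filterS FA => z cz; exists z.
- move=> w Fw; apply: contrapT => /forallNP nF.
  have nFd d : F (~` cyl o (rcons w d)).
    by have [/nF|] := in_ultra_setVsetC (cyl o (rcons w d)) FU.
  have /filter_ex [z [wz nz]] : F (cyl o w `&` [set z | forall d, ~ cyl o (rcons w d) z]).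
    by apply: filterI => //; apply: filter_forall.
  by have [d /nz] := cyl_split wz; apply.
exists (coding p (address u o)); split; first by exists u.
move=> U /= /(@cyl_nbhs u) [n sU].
by apply: filterS sU (hu n).
Qed.

(** If a relatively clopen set splits the curve, it splits one of the quarters,
    since consecutive quarters have a point in common. The pieces obtained by
    repeating this shrink to a point of the curve, near which the clopen set is
    either everything or empty. *)
Lemma curve_connected o : connected (curve o).
Proof.
move=> B [x0 Bx0] [C oC BC] [D cD BD].
have locB z : curve o z -> nbhs z [set y | curve o y -> (B y <-> B z)].
  move=> Az; have [Bz|nBz] := pselect (B z).
    have Cz : C z by move: Bz; rewrite BC => -[].
    apply: filterS (open_nbhs_nbhs (conj oC Cz)) => y Cy Ay; split => // _.
    by rewrite BC.
  have nDz : (~` D) z by move=> Dz; apply: nBz; rewrite BD.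
  have oD : open (~` D) by exact: closed_openC.
  apply: filterS (open_nbhs_nbhs (conj oD nDz)) => y nDy Ay; split => //.
  by rewrite BD => -[_ /nDy].
apply/seteqP; split => [z|z Az]; first by rewrite BC => -[].
apply: contrapT => nBz.
have [||u hu] := @infinite_branch
  (fun w => ~ (forall x y, cyl o w x -> cyl o w y -> B x -> B y)).
- move=> h; apply: nBz; apply: (h x0 z _ _ Bx0); last by exists z.
  by exists x0 => //; move: Bx0; rewrite BC => -[].
- move=> w; apply: contra_notP => /forallNP h x y wx wy.
  pose L (d : 'I_4) := cylmap o w (phi p (d, o w) Pleft).
  have cL d : cyl o (rcons w d) (L d).
    by exists Pleft; [exact: curve_left|rewrite cylmap_rcons].
  have {}h d x' y' : cyl o (rcons w d) x' -> cyl o (rcons w d) y' -> B x' <-> B y'.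
    by have /contrapT hd := h d; split; apply: hd.
  have step (d d' : 'I_4) : val d' = (val d).+1 -> B (L d) <-> B (L d').
    move=> dd'; apply: (h d) => //.
    exists Pright; first exact: curve_right.
    by rewrite cylmap_rcons (phi_joint _ dd').
  have L0 d : B (L d) <-> B (L ord0).
    case: d => n; elim: n => [|n IH] n4.
      by rewrite (_ : Ordinal n4 = ord0) //; exact: val_inj.
    by rewrite -(IH (ltnW n4)); symmetry; exact: step.
  have [d1 x1] := cyl_split wx; have [d2 y2] := cyl_split wy.
  by rewrite (h d1 x (L d1)) // (h d2 y (L d2)) // !L0.
have zc : curve o (coding p (address u o)) by exists u.
have [n hn] := cyl_nbhs (locB _ zc).
by apply: (hu n) => x y cx cy Bx; apply/(hn _ cy (cyl_sub cy))/(hn _ cx (cyl_sub cx)).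
Qed.

End Curves.

(** * Two arms ending at a common point *)

Section Junctions.
Variables (R : realType) (p : R).
Hypothesis hp : 1 / 4 < p <= 1 / 3.
Local Notation q := (qpar p).

(** A multiple of the signed distance to the line through [Pright] with normal
    vector [(1, nu)]. *)
Definition tilt (nu : R) (z : plane R) : R := z.1 - 1 / 2 + nu * z.2.

(** The orthogonal reflection across the zero line of [tilt nu]. *)
Definition mirror (nu : R) (z : plane R) : plane R :=
  let h := 2 * tilt nu z / (1 + nu ^+ 2) in (z.1 - h : R, z.2 - nu * h : R).

Lemma mirror_neq0 (nu : R) : 1 + nu ^+ 2 != 0.
Proof. by rewrite gt_eqF // ltr_wpDr // sqr_ge0. Qed.

Lemma mirror_similarity nu : similarity 1 (mirror nu).
Proof.
apply: similarity_sqr => // -[x1 y1] [x2 y2]; rewrite /mirror /tilt /=.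
by field; exact: mirror_neq0.
Qed.

Lemma tilt_mirror nu z : tilt nu (mirror nu z) = - tilt nu z.
Proof. by rewrite /mirror /tilt /=; field; exact: mirror_neq0. Qed.

Lemma mirror_tangential nu z :
  (mirror nu z).2 - nu * ((mirror nu z).1 - 1 / 2) = z.2 - nu * (z.1 - 1 / 2).
Proof. by rewrite /mirror /tilt /=; field; exact: mirror_neq0. Qed.

Lemma mirror_fixed nu z : tilt nu z = 0 -> mirror nu z = z.
Proof.
move=> t0; rewrite /mirror t0; case: z {t0} => x y /=; congr pair;
  by field; exact: mirror_neq0.
Qed.

Lemma mirror_Pright nu : mirror nu (Pright R) = Pright R.
Proof. by apply: mirror_fixed; rewrite /tilt /=; field. Qed.

Lemma phi_last b (z : plane R) :
  phi p (ord_max, b) z = (p * z.1 + (1 - p) / 2 : R, p * z.2 : R).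
Proof. by case: z => x y. Qed.

(** The last similitude is a homothety with centre [Pright], which is on the
    mirror. This makes the last quarters of two arms a scaled copy of two arms. *)
Lemma mirror_phi nu b b' z :
  mirror nu (phi p (ord_max, b) z) = phi p (ord_max, b') (mirror nu z).
Proof.
rewrite !phi_last; case: z => x y; rewrite /mirror /tilt /=; congr pair;
  by field; exact: mirror_neq0.
Qed.

Lemma tilt_edist nu x y : `|tilt nu x - tilt nu y| <= (1 + `|nu|) * edist x y.
Proof.
rewrite (_ : _ - _ = (x.1 - y.1) + nu * (x.2 - y.2)); last by rewrite /tilt; ring.
apply: le_trans (ler_normD _ _) _; rewrite normrM mulrDl mul1r.
by apply: lerD; [exact: ler_edist1|apply: ler_wpM2l (ler_edist2 x y)].
Qed.

(** The arms [curve a] and [mirror nu @` curve b] have the end point [Pright] in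
    common, so only their last quarters, the ones next to [Pright], are
    allowed to come closer than [c]. *)
Definition arms_apart (c nu : R) (a b : tree) :=
  forall x y, curve p a x -> curve p b y ->
    (exists x' y', [/\ curve p (subtree a [:: ord_max]) x',
        curve p (subtree b [:: ord_max]) y',
        x = phi p (ord_max, a [::]) x' & y = phi p (ord_max, b [::]) y'])
    \/ c <= edist x (mirror nu y).

(** Undo the homothety of the last quarters until the points are [c] apart; the
    two arms together then join them. The number [8] bounds the diameter of the
    union of the two arms. *)
Lemma linked_arms c nu a b : 0 < c ->
  (forall n, arms_apart c nu (subtree a (nseq n ord_max)) (subtree b (nseq n ord_max))) ->
  forall x y, curve p a x -> curve p b y ->
  linked (8 / c) (curve p a `|` mirror nu @` curve p b) x (mirror nu y).
Proof.
move=> c0 hab x y ax byy.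
have [e0|/eqP ne0] := pselect (edist x (mirror nu y) = 0).
  by rewrite -(edist_eq0 e0); apply: linked_refl; left.
have [N hN] : exists N : nat, 8 * p ^+ N < edist x (mirror nu y).
  have d0 : 0 < edist x (mirror nu y) / 2 by
    by rewrite divr_gt0 // lt_neqAle eq_sym ne0 edist_ge0.
  by have [N hN] := lt_exp_p hp d0; exists N; lra.
have diam8 a' b' u v : (curve p a' `|` mirror nu @` curve p b') u ->
    (curve p a' `|` mirror nu @` curve p b') v -> edist u v <= 8.
  have toP w : (curve p a' `|` mirror nu @` curve p b') w -> edist w (Pright R) <= 4.
    move=> [aw|[w' bw <-]].
      by apply: (curve_edist hp aw); exact: curve_right.
    rewrite -(mirror_Pright nu) mirror_similarity mul1r.
    by apply: (curve_edist hp bw); exact: curve_right.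
  move=> /toP hu /toP hv; apply: le_trans (edist_triangle (Pright R) _ _) _.
  by rewrite (edistC _ v); lra.
elim: N a b hab x y ax byy hN {ne0} => [|N IH] a b hab x y ax byy hN.
  exfalso; move: hN; rewrite expr0 mulr1 ltNge => /negP; apply.
  by apply: (diam8 a b); [left|right; exists y].
have [[x' [y' [ax' by' ex ey]]]|cd] := hab 0%N x y ax byy; last first.
  exists (curve p a `|` mirror nu @` curve p b); split => //.
  - have mc : {within curve p b, continuous (mirror nu)}.
      by apply: continuous_subspaceT; exact: similarity_continuous (mirror_similarity nu).
    split; first by apply: compactU; [|apply: continuous_compact => //]; exact: curve_compact.
    apply: connectedU; [|exact: curve_connected|].
      exists (Pright R); split; first exact: curve_right.
      by exists (Pright R); [exact: curve_right|exact: mirror_Pright].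
    by apply: connected_continuous_connected => //; exact: curve_connected.
  - by left.
  - by right; exists y.
  - move=> u v Gu Gv; apply: le_trans (diam8 a b _ _ Gu Gv) _.
    rewrite mulrAC ler_pdivlMr //; apply: ler_wpM2l => //.
have my : mirror nu y = phi p (ord_max, a [::]) (mirror nu y').
  by rewrite ey (mirror_phi _ _ (a [::])).
have p0 := p_gt0 hp.
have h := linked_image (ltW p0) (phi_similarity hp (ord_max, a [::]))
  (IH (subtree a [:: ord_max]) (subtree b [:: ord_max]) _ x' y' ax' by' _).
rewrite my ex; apply: linked_sub (h _ _) => //.
- move=> _ [z [az|[z' bz <-]] <-]; first by left; exact: curve_phi.
  right; exists (phi p (ord_max, b [::]) z'); first exact: curve_phi.
  by rewrite (mirror_phi _ _ (a [::])).
- move=> n; rewrite -!subtree_cat.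
  exact: (hab n.+1).
- move: hN; rewrite my ex (phi_similarity hp) exprS mulrCA.
  by rewrite ltr_pM2l.
Qed.

Lemma phi_not_last d b z : d != ord_max -> rhombus p z ->
  (phi p (d, b) z).1 <= 1 / 2 - p.
Proof.
move=> dmax /(rhombus_coords hp) [x [Y [-> dY]]]; have [d1 d2 d3 d4] := dY.
rewrite phiE //; move: (hp) => /andP[p1 p2].
have [p1' p2'] : 0 <= p - 1 / 4 /\ 0 <= 1 / 3 - p by split; lra.
have [a1 a2 a3 a4] := diamond_scale p1' dY.
have [b1 b2 b3 b4] := diamond_scale p2' dY.
case: d dmax => [[|[|[|[|]]]] // ?] //= _;
  try case: (bump_signP R b) => e; rewrite ?e; lra.
Qed.

(** The edges of the rhombus at [Pright] have slopes [q] and [- q]; the mirror is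
    steeper than both when [|nu| * q < 1]. *)
Lemma tilt_rhombus nu z : rhombus p z ->
  tilt nu z <= - (1 - `|nu| * q) * (1 / 2 - z.1).
Proof.
move=> /(rhombus_coords hp) [x [Y [-> [d1 d2 d3 d4]]]]; rewrite /tilt /=.
suff : nu * (q * Y) <= `|nu| * q * (1 / 2 - x) by lra.
apply: le_trans (ler_norm _) _; rewrite !normrM (gtr0_norm (q_gt0 hp)) mulrA.
apply: ler_wpM2l; first by rewrite mulr_ge0 // ltW // q_gt0.
by rewrite ler_norml; apply/andP; split; lra.
Qed.

(** The two arms lie on different sides of the mirror, and a point outside the
    last quarter has abscissa at most [1/2 - p], hence a distance to the mirror
    that is bounded from below. *)
Lemma arms_apart_wide nu a b : `|nu| * q < 1 ->
  arms_apart ((1 - `|nu| * q) * p / (1 + `|nu|)) nu a b.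
Proof.
move=> nuq x y ax byy.
have [d [x' [ax' ex]]] := curve_split hp ax; have [d' [y' [by' ey]]] := curve_split hp byy.
have [[ed ed']|nlast] := pselect (d = ord_max /\ d' = ord_max).
  by left; exists x', y'; subst d d'.
right; rewrite ler_pdivrMr ?ltr_wpDr // mulrC.
apply: le_trans (_ : _ <= `|tilt nu x - tilt nu (mirror nu y)|) _; last first.
  by rewrite mulrC; exact: tilt_edist.
rewrite tilt_mirror opprK -[leRHS]normrN; apply: le_trans (ler_norm _).
have Vx := curve_rhombus hp ax; have Vy := curve_rhombus hp byy.
have := tilt_rhombus nu Vx; have := tilt_rhombus nu Vy.
have side z : rhombus p z -> (0 : R) <= (1 / 2 : R) - z.1.
  by move=> /(rhombus_coords hp) [u [Y [-> [d1 d2 d3 d4]]]] /=; lra.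
have k0 : 0 <= 1 - `|nu| * q by rewrite subr_ge0 ltW.
have : p <= (1 / 2 - x.1) + (1 / 2 - y.1).
  have sx := side _ Vx; have sy := side _ Vy.
  have [dm|nd] := eqVneq d ord_max.
    have nd' : d' != ord_max by apply/eqP => dm'; apply: nlast.
    have := phi_not_last (b [::]) nd' (curve_rhombus hp by'); rewrite -ey; lra.
  have := phi_not_last (a [::]) nd (curve_rhombus hp ax'); rewrite -ex; lra.
move=> /(ler_wpM2l k0); rewrite mulrDr; lra.
Qed.

End Junctions.

(** * The joints of a curve *)

Definition digit1 : 'I_4 := @Ordinal 4 1 isT.
Definition digit2 : 'I_4 := @Ordinal 4 2 isT.

Section CurveTurning.
Variables (R : realType) (p : R).
Hypothesis hp : 1 / 4 < p <= 1 / 3.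
Local Notation q := (qpar p).

(** For [p = 1/3] the mirror with [nu = - bump_sign e * (3 * q)] carries an edge
    of the rhombus. [L] is [tilt nu], and [M] is, up to a positive factor, the
    coordinate along the mirror, growing towards [Pright]. A bump that points
    towards the mirror can come close to it only where [M] is near [-4/3] or
    less, behind the last quarter. *)
Lemma tip_piece (e a : 'I_2) d z : p = 1 / 3 -> rhombus p z ->
  exists X Y : R, let L := X - 1 / 2 - bump_sign R e * Y in
    let M := 3 * (X - 1 / 2) + bump_sign R e * Y in
    [/\ phi p (d, a) z = (X, q * Y), L <= 0, d = ord_max -> -1 <= M &
      d != ord_max -> L <= - (1 / 6) \/ a <> e /\ L + M <= - (4 / 3)].
Proof.
move=> p3 /(rhombus_coords hp) [x [Y [-> [k1 k2 k3 k4]]]].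
rewrite phiE // p3.
case: d => [[|[|[|[|]]]] // ?]; do 2!eexists; (split; [reflexivity| | |]); rewrite /=.
all: try by move=> /(congr1 val).
all: try by move=> /eqP []; exact: val_inj.
all: move=> *; have [ae|/eqP ae] := eqVneq a e; rewrite ?ae;
  case: (bump_signP R e) => he; rewrite ?he; case: (bump_signP R a) => ha; rewrite ?ha;
  by [lra|left; lra|right; split => //; lra].
Qed.

(** A point outside the last quarter is far from the mirror, unless it is on a
    bump that points towards it. Then the other point is either outside its last
    quarter and far from the mirror, since its bump points away, or in its last
    quarter; in that case a small distance normal to the mirror forces both
    points close to the mirror, and they are apart in the direction of [M]. *)
Lemma arms_apart_tight e a b : p = 1 / 3 ->
  ~ (a [::] <> e /\ b [::] <> e) ->
  arms_apart p (1 / 27) (- bump_sign R e * (3 * q)) a b.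
Proof.
move=> p3 nab x y ax byy.
have [d [x' [ax' ex]]] := curve_split hp ax; have [d' [y' [by' ey]]] := curve_split hp byy.
have [[ed ed']|nlast] := pselect (d = ord_max /\ d' = ord_max).
  by left; exists x', y'; subst d d'.
right.
have [X [Y [eX L1 top1 low1]]] := tip_piece e (a [::]) d p3 (curve_rhombus hp ax').
have [X2 [Y2 [eX2 L2 top2 low2]]] := tip_piece e (b [::]) d' p3 (curve_rhombus hp by').
set nu := - bump_sign R e * (3 * q); set D := edist _ _.
have q0 := q_gt0 hp; have q1 := q_le1 hp; have qq := sqr_q hp.
have qh : 1 / 2 <= q by nra.
have nuq : `|nu| = 3 * q.
  rewrite /nu normrM normrN (gtr0_norm (_ : 0 < 3 * q)) ?mulr_gt0 //.
  by case: (bump_signP R e) => ->; rewrite ?normrN normr1 mul1r.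
have D0 : 0 <= D by exact: edist_ge0.
have tx : tilt nu x = X - 1 / 2 - bump_sign R e * Y.
  rewrite ex eX /tilt /nu /=.
  rewrite (_ : _ * (q * Y) = - (3 * (q * q)) * (bump_sign R e * Y)); last by ring.
  by rewrite qq p3; field.
have ty : tilt nu y = X2 - 1 / 2 - bump_sign R e * Y2.
  rewrite ey eX2 /tilt /nu /=.
  rewrite (_ : _ * (q * Y2) = - (3 * (q * q)) * (bump_sign R e * Y2)); last by ring.
  by rewrite qq p3; field.
have normal : - (tilt nu x + tilt nu y) <= 4 * D.
  apply: le_trans (_ : (1 + `|nu|) * D <= _); last by rewrite nuq; nra.
  apply: le_trans (tilt_edist nu _ _).
  by rewrite tilt_mirror opprK -[leRHS]normrN ler_norm.
have tangent (s : R) : s = 1 \/ s = -1 ->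
    s * (3 * (X2 - X) + bump_sign R e * (Y2 - Y)) <= 5 * D.
  move=> s1; have m1 := ler_edist1 x (mirror nu y); have m2 := ler_edist2 x (mirror nu y).
  rewrite -(ler_pM2l q0).
  apply: le_trans (_ : (1 + 3 * q) * D <= _); last by nra.
  apply: le_trans (_ : `|(x.2 - (mirror nu y).2) - nu * (x.1 - (mirror nu y).1)| <= _).
    have -> : x.2 - (mirror nu y).2 - nu * (x.1 - (mirror nu y).1) =
        x.2 - nu * (x.1 - 1 / 2) - (y.2 - nu * (y.1 - 1 / 2)).
      by rewrite -(mirror_tangential nu y); ring.
    rewrite ex eX ey eX2 /nu /=.
    apply: le_trans (_ : `|q * (3 * (X2 - X) + bump_sign R e * (Y2 - Y))| <= _).
      apply: le_trans (ler_norm _) _; rewrite !normrM.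
      by case: s1 => ->; rewrite ?normrN normr1 mul1r.
    by case: (bump_signP R e) => he; rewrite he;
      [rewrite -normrN|]; rewrite le_eqVlt; apply/orP; left; apply/eqP;
      congr (`|_|); ring.
  apply: le_trans (ler_normB _ _) _; rewrite normrM nuq [leRHS]mulrDl mul1r.
  by apply: lerD => //; apply: ler_wpM2l m1; rewrite mulr_ge0 // ltW.
have t1 := tangent 1 (or_introl erefl); have t2 := tangent (-1) (or_intror erefl).
move: normal; rewrite tx ty => normal.
have [dm|nd] := eqVneq d ord_max.
  have nd' : d' != ord_max by apply/eqP => dm'; apply: nlast.
  have := top1 dm; case: (low2 nd') => [|[_ h]]; lra.
have [dm'|nd'] := eqVneq d' ord_max.
  have := top2 dm'; case: (low1 nd) => [|[_ h]]; lra.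
case: (low1 nd) => [|[ae _]]; first by lra.
case: (low2 nd') => [|[be _]]; first by lra.
by case: nab.
Qed.

(** A form of the mirror without [q] and without divisions: [h] can be given in
    any form that suits the slope at hand. *)
Lemma mirrorE (mu x Y h : R) :
  (1 + mu ^+ 2 * (4 * p - 1)) * h = 2 * (x - 1 / 2 + mu * (4 * p - 1) * Y) ->
  mirror (mu * q) (x, q * Y) = (x - h, q * (Y - mu * h)).
Proof.
have := mirror_neq0 (mu * q); rewrite /mirror /tilt /= exprMn [q ^+ 2]expr2 (sqr_q hp).
rewrite (_ : mu * q * (q * Y) = mu * (4 * p - 1) * Y); last first.
  by rewrite -(sqr_q hp); ring.
move=> d0 <-; rewrite [_ * h]mulrC mulfK //; congr pair; ring.
Qed.

Lemma bump_sign_sqr b : bump_sign R b ^+ 2 = 1.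
Proof. by case: (bump_signP R b) => ->; rewrite ?sqrrN expr1n. Qed.

(** At the two joints on the axis the curve turns by twice the angle between the
    axis and an edge of the rhombus. *)
Lemma base_joint (d d' : 'I_4) b z : (val d, val d') \in [:: (0, 1); (2, 3)]%N ->
  phi p (d', b) (flip z) = phi p (d, b) (mirror (bump_sign R b * q) z).
Proof.
move=> dd'; case: z => x y; have [Y ->] := stretchE hp y.
have p0 := lt0r_neq0 (p_gt0 hp).
rewrite (_ : flip (x, q * Y) = (- x : R, q * Y : R)) //.
rewrite (@mirrorE _ _ _ ((x - 1 / 2 + bump_sign R b * (4 * p - 1) * Y) / (2 * p))); last first.
  by rewrite bump_sign_sqr; field.
rewrite !phiE //.
case: d dd' => [[|[|[|[|]]]] // ?] /=; case: d' => [[|[|[|[|]]]] // ?] //= _;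
  case: (bump_signP R b) => he; rewrite ?he; congr (_, q * _); by field.
Qed.

(** At the apex the curve turns back by four times that angle; [q / (1 - 2 * p)]
    is the tangent of its double. *)
Lemma apex_joint b z :
  phi p (digit2, b) (flip z) =
  phi p (digit1, b) (mirror (- bump_sign R b / (1 - 2 * p) * q) z).
Proof.
case: z => x y; have [Y ->] := stretchE hp y.
have p0 := lt0r_neq0 (p_gt0 hp).
have p1 : 1 - 2 * p != 0 by rewrite gt_eqF //; move: hp => /andP[]; lra.
rewrite (_ : flip (x, q * Y) = (- x : R, q * Y : R)) //.
rewrite (@mirrorE _ _ _ ((x - 1 / 2 - bump_sign R b / (1 - 2 * p) * (4 * p - 1) * Y) *
  (1 - 2 * p) ^+ 2 / (2 * p ^+ 2))); last first.
  by rewrite exprMn sqrrN bump_sign_sqr; field; rewrite p1 p0.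
rewrite !phiE //=.
case: (bump_signP R b) => he; rewrite ?he; congr (_, q * _); by field; rewrite p1 p0.
Qed.

(** The two arms at the apex of the piece [w] are its quarters [1] and [2]. At the
    [n]-th scale they are the pieces [w 1 3^n] and [w 2 0^n], whose bumps point
    towards each other exactly if both differ from the bump of [w]. For
    [p < 1/3] such pairs do no harm. *)
Definition apices_avoid (o : tree) := p = 1 / 3 -> forall w n,
  ~ (o (w ++ digit1 :: nseq n ord_max) <> o w /\ o (w ++ digit2 :: nseq n ord0) <> o w).

Lemma apices_avoid_sub o w : apices_avoid o -> apices_avoid (subtree o w).
Proof. by move=> h p3 v n; rewrite /subtree !catA; apply: h. Qed.

Lemma map_rev_nseq n : map (@rev_ord 4) (nseq n ord_max) = nseq n ord0.
Proof. by rewrite map_nseq; congr nseq; apply: val_inj. Qed.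

(** For [p < 1/3] the mirror at the apex is steep enough, as
    [q ^ 2 < 1 - 2 * p]. *)
Lemma apex_arms_apart : exists2 c : R, 0 < c & forall o, apices_avoid o -> forall n,
  arms_apart p c (- bump_sign R (o [::]) / (1 - 2 * p) * q)
    (subtree (subtree o [:: digit1]) (nseq n ord_max))
    (subtree (revtree (subtree o [:: digit2])) (nseq n ord_max)).
Proof.
have q0 := q_gt0 hp; have qq := sqr_q hp; move: (hp) => /andP[p1 p2].
have p12 : 0 < 1 - 2 * p by lra.
have [p3|/eqP np3] := pselect (p = 1 / 3).
  exists (1 / 27) => // o ho n.
  rewrite (_ : _ / _ * q = - bump_sign R (o [::]) * (3 * q)); last by rewrite p3; field.
  apply: arms_apart_tight => //.
  rewrite subtree_revtree /subtree /revtree /= map_rev_nseq !cats0.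
  exact: (ho p3 [::] n).
have {np3} p3 : p < 1 / 3 by rewrite lt_neqAle np3.
have nuE b : `|- bump_sign R b / (1 - 2 * p) * q| = q / (1 - 2 * p).
  rewrite !normrM normfV (gtr0_norm q0) (gtr0_norm p12) normrN.
  by case: (bump_signP R b) => ->; rewrite ?normrN normr1 mul1r mulrC.
have small : q / (1 - 2 * p) * q < 1.
  by rewrite mulrAC qq ltr_pdivrMr //; lra.
exists ((1 - q / (1 - 2 * p) * q) * p / (1 + q / (1 - 2 * p))).
  rewrite divr_gt0 //; last by rewrite addr_gt0 // divr_gt0.
  by rewrite mulr_gt0 ?subr_gt0 // p_gt0.
move=> o _ n.
have := @arms_apart_wide _ _ hp (- bump_sign R (o [::]) / (1 - 2 * p) * q).
by rewrite nuE; apply.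
Qed.

Lemma base_arms_apart : exists2 c : R, 0 < c & forall (b : 'I_2) a1 a2,
  arms_apart p c (bump_sign R b * q) a1 a2.
Proof.
have q0 := q_gt0 hp; have qq := sqr_q hp; move: (hp) => /andP[p1 p2].
have nuE b : `|bump_sign R b * q| = q.
  rewrite !normrM (gtr0_norm q0).
  by case: (bump_signP R b) => ->; rewrite ?normrN normr1 mul1r.
exists ((1 - q * q) * p / (1 + q)).
  rewrite divr_gt0 ?addr_gt0 // mulr_gt0 ?(p_gt0 hp) //; lra.
move=> b a1 a2; have := @arms_apart_wide _ _ hp (bump_sign R b * q) a1 a2.
by rewrite nuE; apply; lra.
Qed.

(** [flip] turns the quarter that starts at the joint into one that ends
    there. *)
Lemma linked_joint c nu (o : tree) (d d' : 'I_4) : 0 < c ->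
  (forall z, phi p (d', o [::]) (flip z) = phi p (d, o [::]) (mirror nu z)) ->
  (forall n, arms_apart p c nu (subtree (subtree o [:: d]) (nseq n ord_max))
     (subtree (revtree (subtree o [:: d'])) (nseq n ord_max))) ->
  forall x y, curve p (subtree o [:: d]) x -> curve p (subtree o [:: d']) y ->
  linked (8 / c) (curve p o) (phi p (d, o [::]) x) (phi p (d', o [::]) y).
Proof.
move=> c0 hj ha x y ax byy.
have h := linked_image (ltW (p_gt0 hp)) (phi_similarity hp (d, o [::]))
  (linked_arms hp c0 ha ax (curve_flip hp byy)).
rewrite -hj flipK in h; apply: linked_sub h => //.
move=> _ [z [az|[w bw <-]] <-]; first exact: curve_phi.
rewrite -hj; apply: (curve_phi hp).
by have := curve_flip hp bw; rewrite revtreeK.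
Qed.

Lemma phi_abscissa d b z : rhombus p z ->
  [/\ val d = 0%N -> (phi p (d, b) z).1 <= p - 1 / 2,
      val d = 1%N -> (phi p (d, b) z).1 <= 0,
      val d = 2%N -> 0 <= (phi p (d, b) z).1 &
      val d = 3%N -> 1 / 2 - p <= (phi p (d, b) z).1].
Proof.
move=> /(rhombus_coords hp) [x [Y [-> dY]]]; have [k1 k2 k3 k4] := dY.
rewrite phiE //.
move: (hp) => /andP[p1 p2].
have [p1' p2'] : 0 <= p - 1 / 4 /\ 0 <= 1 / 3 - p by split; lra.
have [a1 a2 a3 a4] := diamond_scale p1' dY.
have [b1 b2 b3 b4] := diamond_scale p2' dY.
case: d => [[|[|[|[|]]]] // ?]; split=> //= _; try case: (bump_signP R b) => e; rewrite ?e; lra.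
Qed.

(** The induction is on [N], which bounds how often both points can be in the
    same quarter: the distance of the points grows by the factor [1 / p] each
    time. The constant does not depend on the tree. *)
Lemma curve_turning : exists C : R, forall o, apices_avoid o ->
  forall x y, curve p o x -> curve p o y -> linked C (curve p o) x y.
Proof.
have [c c0 apexA] := apex_arms_apart; have [c' c0' baseA] := base_arms_apart.
pose C := Num.max (Num.max (8 / c) (8 / c')) 24.
have C1 : 8 / c <= C by rewrite !le_max lexx.
have C2 : 8 / c' <= C by rewrite !le_max lexx orbT.
have C3 : 24 <= C by rewrite le_max lexx orbT.
exists C => o ho x y ox oy.
have [e0|/eqP ne0] := pselect (edist x y = 0).
  by rewrite -(edist_eq0 e0); apply: linked_refl.
have [N hN] : exists N : nat, 4 * p ^+ N < edist x y.
  by apply: (lt_exp_p hp); rewrite lt_neqAle eq_sym ne0 edist_ge0.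
elim: N o ho x y ox oy hN {ne0} => [|N IH] o ho x y ox oy hN.
  exfalso; move: hN; rewrite expr0 mulr1 ltNge => /negP; apply.
  exact: (curve_edist hp ox).
have [i [x' [ox' ex]]] := curve_split hp ox; have [j [y' [oy' ey]]] := curve_split hp oy.
wlog ij : x y x' y' i j ox oy hN ox' oy' ex ey / (i <= j)%N.
  move=> h; have [ij|/ltnW ji] := leqP i j; first exact: (h x y x' y' i j).
  by apply: linked_sym; apply: (h y x y' x' j i) => //; rewrite edistC.
have [eij|nij] := eqVneq i j.
  subst j; rewrite ex ey.
  have h := linked_image (ltW (p_gt0 hp)) (phi_similarity hp (i, o [::]))
    (IH _ (apices_avoid_sub ho) x' y' ox' oy' _).
  apply: linked_sub (h _) => //.
    by move=> _ [z cz <-]; exact: curve_phi.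
  move: hN; rewrite ex ey (phi_similarity hp) exprS mulrCA.
  by rewrite ltr_pM2l // p_gt0.
have [dist|] := leP (1 / 6) (edist x y).
  exists (curve p o); split => //.
    by split; [exact: curve_compact|exact: curve_connected].
  move=> u v ou ov; apply: le_trans (curve_edist hp ou ov) _.
  apply: le_trans (_ : 24 * edist x y <= _); first by lra.
  by apply: ler_wpM2r => //; exact: edist_ge0.
(* a vertical strip of width [1/6] separates quarters that are not consecutive *)
move=> near.
have {near} near : y.1 - x.1 < 1 / 6.
  by apply: le_lt_trans near; rewrite edistC (le_trans (ler_norm _)) // ler_edist1.
have [xa xb xc xd] := phi_abscissa i (o [::]) (curve_rhombus hp ox').
have [ya yb yc yd] := phi_abscissa j (o [::]) (curve_rhombus hp oy').
move: (hp) => /andP[p1 p2].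
have base : (val i, val j) \in [:: (0, 1); (2, 3)]%N -> linked C (curve p o) x y.
  move=> hij; apply: (linked_sub C2 (@subset_refl _ _)); rewrite ex ey.
  apply: (linked_joint c0' (nu := bump_sign R (o [::]) * q)) => //.
  by move=> z; exact: base_joint.
have apex : i = digit1 -> j = digit2 -> linked C (curve p o) x y.
  move=> hi hj; apply: (linked_sub C1 (@subset_refl _ _)); rewrite ex ey.
  subst i j; apply: (linked_joint c0 (nu := - bump_sign R (o [::]) / (1 - 2 * p) * q)) => //.
    exact: apex_joint.
  exact: apexA.
rewrite -ex in xa xb xc xd; rewrite -ey in ya yb yc yd.
move: ij nij base apex xa xb xc xd ya yb yc yd.
case: i {ex ox'} => [[|[|[|[|]]]] // ?]; case: j {ey oy'} => [[|[|[|[|]]]] // ?] // _ _ base apex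
  xa xb xc xd ya yb yc yd.
all: try by apply: base.
all: try by apply: apex; exact: val_inj.
all: exfalso.
- have := xa erefl; have := yc erefl; lra.
- have := xa erefl; have := yd erefl; lra.
- have := xb erefl; have := yd erefl; lra.
Qed.

End CurveTurning.

(** * The three sides of a snowflake *)

Section Snowflake.
Variables (R : realType) (p : R).
Hypothesis hp : 1 / 4 < p <= 1 / 3.
Local Notation q := (qpar p).
Local Notation sqrt3 := (Num.sqrt 3 : R).

Lemma sqr_sqrt3 : sqrt3 * sqrt3 = 3.
Proof. by rewrite -expr2 sqr_sqrtr. Qed.

(** At the corner [Pright] the snowflake turns by 120 degrees, so the mirror makes
    an angle of 30 degrees with the side. *)
Lemma f1_flip (z : plane R) : f1 (flip z) = mirror (- sqrt3) z.
Proof.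
case: z => x y; rewrite /mirror /tilt /f1 /flip /= sqrrN expr2 sqr_sqrt3.
congr pair; first by field.
apply/eqP; rewrite -subr_eq0; apply/eqP.
rewrite [LHS](_ : _ = (sqrt3 * sqrt3 - 3) * y / 2); last by field.
by rewrite sqr_sqrt3 subrr !mul0r.
Qed.

(** The three sides are permuted by the rotation [f1] about the centre of the
    triangle, so all corners are images of a single one. *)
Lemma f1_f1 (z : plane R) : f1 (f1 z) = f2 z.
Proof.
case: z => x y; rewrite /f1 /f2 /=; congr pair.
- apply/eqP; rewrite -subr_eq0; apply/eqP.
  rewrite [LHS](_ : _ = (3 - sqrt3 * sqrt3) * (x / 4 + 1 / 8)); last by field.
  by rewrite sqr_sqrt3 subrr !mul0r.
- apply/eqP; rewrite -subr_eq0; apply/eqP.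
  rewrite [LHS](_ : _ = (3 - sqrt3 * sqrt3) * y / 4); last by field.
  by rewrite sqr_sqrt3 subrr !mul0r.
Qed.

Lemma f2_f1 (z : plane R) : f2 (f1 z) = z.
Proof.
case: z => x y; rewrite /f1 /f2 /=; congr pair.
- apply/eqP; rewrite -subr_eq0; apply/eqP.
  rewrite [LHS](_ : _ = (sqrt3 * sqrt3 - 3) * (x / 4 + 1 / 8)); last by field.
  by rewrite sqr_sqrt3 subrr !mul0r.
- apply/eqP; rewrite -subr_eq0; apply/eqP.
  rewrite [LHS](_ : _ = (sqrt3 * sqrt3 - 3) * y / 4); last by field.
  by rewrite sqr_sqrt3 subrr !mul0r.
Qed.

Lemma f1_similarity : similarity 1 (@f1 R).
Proof.
apply: similarity_sqr => // -[x1 y1] [x2 y2]; rewrite /f1 /=.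
rewrite [LHS](_ : _ = (1 + sqrt3 * sqrt3) / 4 *
  ((x1 - x2) ^+ 2 + (y1 - y2) ^+ 2)); last by field.
by rewrite sqr_sqrt3; field.
Qed.

Lemma f2_similarity : similarity 1 (@f2 R).
Proof. by move=> x y; rewrite -!f1_f1 !f1_similarity !mul1r. Qed.

(** The side [f1 @` curve b] begins at the right end of [curve a]. On both sides
    the bumps with orientation [0] point out of the triangle; the others are the
    ones that can meet across the mirror. *)
Definition corner_avoids (a b : tree) := p = 1 / 3 -> forall n,
  ~ (a (nseq n ord_max) <> ord0 /\ b (nseq n ord0) <> ord0).

(** For [p = 1/3] a corner looks like the apex of a bump that points up. *)
Lemma sqrt3_tight : p = 1 / 3 -> sqrt3 = 3 * q.
Proof.
move=> p3; have qq := sqr_q hp; have q0 := q_gt0 hp.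
have s0 : 0 <= sqrt3 by exact: sqrtr_ge0.
apply/eqP; rewrite -(@eqrXn2 _ 2) //; last by rewrite mulr_ge0 // ltW.
apply/eqP; rewrite !expr2 sqr_sqrt3 (_ : 3 * q * (3 * q) = 9 * (q * q)); last by ring.
by rewrite qq p3; field.
Qed.

Lemma corner_arms_apart : exists2 c : R, 0 < c &
  forall a b, corner_avoids a b -> forall n,
  arms_apart p c (- sqrt3) (subtree a (nseq n ord_max))
    (subtree (revtree b) (nseq n ord_max)).
Proof.
have q0 := q_gt0 hp; have qq := sqr_q hp; move: (hp) => /andP[p1 p2].
have s0 : 0 <= sqrt3 by exact: sqrtr_ge0.
have [p3|/eqP np3] := pselect (p = 1 / 3).
  exists (1 / 27) => // a b hab n.
  rewrite (_ : - sqrt3 = - bump_sign R ord0 * (3 * q)); last first.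
    by rewrite sqrt3_tight // /bump_sign expr0 mulN1r.
  apply: arms_apart_tight => //.
  rewrite subtree_revtree /subtree /revtree /= map_rev_nseq !cats0.
  exact: (hab p3 n).
have {np3} p3 : p < 1 / 3 by rewrite lt_neqAle np3.
have small : `|- sqrt3| * q < 1.
  rewrite normrN ger0_norm // -(@ltr_pXn2r _ 2) ?nnegrE ?mulr_ge0 //; last exact: ltW.
  rewrite expr1n expr2 (_ : sqrt3 * q * (sqrt3 * q) = (sqrt3 * sqrt3) * (q * q)); last by ring.
  by rewrite sqr_sqrt3 qq; lra.
exists ((1 - `|- sqrt3| * q) * p / (1 + `|- sqrt3|)).
  by rewrite divr_gt0 ?ltr_wpDr // mulr_gt0 ?subr_gt0 // p_gt0.
by move=> a b _ n; apply: arms_apart_wide.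
Qed.

Lemma linked_corner : exists C : R, forall a b, corner_avoids a b ->
  forall x y, curve p a x -> curve p b y ->
  linked C (curve p a `|` f1 @` curve p b) x (f1 y).
Proof.
have [c c0 hc] := corner_arms_apart; exists (8 / c) => a b hab x y ax bY.
have := linked_arms hp c0 (hc a b hab) ax (curve_flip hp bY).
rewrite -f1_flip flipK; apply: linked_sub => // z [az|[w bw <-]]; first by left.
right; rewrite -f1_flip; exists (flip w) => //.
by have := curve_flip hp bw; rewrite revtreeK.
Qed.

Lemma snowflake_turning (a b c : tree) :
  apices_avoid p a -> apices_avoid p b -> apices_avoid p c ->
  corner_avoids a b -> corner_avoids b c -> corner_avoids c a ->
  bounded_turning (curve p a `|` f1 @` curve p b `|` f2 @` curve p c).
Proof.
move=> ha hb hc hab hbc hca; set F := (X in bounded_turning X).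
have [C1 arc] := curve_turning hp; have [C2 corner] := linked_corner.
pose C := Num.max C1 C2.
have l1 : C1 <= C by rewrite le_max lexx.
have l2 : C2 <= C by rewrite le_max lexx orbT.
have Fa : curve p a `<=` F by move=> z; left; left.
have Fb : f1 @` curve p b `<=` F by move=> z; left; right.
have Fc : f2 @` curve p c `<=` F by move=> z; right.
have f12 z : f1 (f2 z) = z :> plane R by rewrite -f1_f1 f1_f1 f2_f1.
have ab x y : curve p a x -> curve p b y -> linked C F x (f1 y).
  move=> ax bY; apply: linked_sub (corner a b hab x y ax bY) => //.
  by move=> z [/Fa|/Fb].
have bc x y : curve p b x -> curve p c y -> linked C F (f1 x) (f2 y).
  move=> ax bY; rewrite -f1_f1.
  apply: linked_sub (linked_image ler01 f1_similarity (corner b c hbc x y ax bY)) => //.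
  move=> _ [z [bz|[w cw <-]] <-]; first by apply: Fb; exists z.
  by apply: Fc; exists w => //; rewrite f1_f1.
have ca x y : curve p c x -> curve p a y -> linked C F (f2 x) y.
  move=> ax bY; rewrite -[y]f2_f1.
  apply: linked_sub (linked_image ler01 f2_similarity (corner c a hca x y ax bY)) => //.
  move=> _ [z [bz|[w cw <-]] <-]; first by apply: Fc; exists z.
  by apply: Fa; rewrite f2_f1.
apply: (@linked_bounded_turning _ C) => x y.
move=> [[ax|[x' ax <-]]|[x' ax <-]] [[ay|[y' ay <-]]|[y' ay <-]].
- exact: linked_sub (arc a ha x y ax ay).
- exact: ab.
- exact/linked_sym/ca.
- exact/linked_sym/ab.
- exact: linked_sub (linked_image ler01 f1_similarity (arc b hb x' y' ax ay)).
- exact: bc.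
- exact: ca.
- exact/linked_sym/bc.
- exact: linked_sub (linked_image ler01 f2_similarity (arc c hc x' y' ax ay)).
Qed.

End Snowflake.

(** * Base 4 expansions *)

Definition tree_of (s : orientations) : tree :=
  fun w => s (size w) (Ordinal (base4_prefix_lt (nth ord0 w) (size w))).

(** Compares orientations at levels that are only provably equal. *)
Lemma orientations_eq (s : orientations) k k' (i : 'I_(4 ^ k)) (i' : 'I_(4 ^ k')) :
  k = k' -> val i = val i' -> s k i = s k' i'.
Proof. by move=> kk; subst k' => /val_inj ->. Qed.

Lemma omega_address u s : omega u s = address u (tree_of s).
Proof.
apply/funext => k; rewrite /omega /address /tree_of; congr (_, _).
apply: orientations_eq; first by rewrite size_mkseq.
rewrite /= size_mkseq /base4_prefix; apply: eq_bigr => j _.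
by rewrite nth_mkseq.
Qed.

Lemma base4_prefixS u n : base4_prefix u n.+1 = (4 * base4_prefix u n + u n)%N.
Proof.
rewrite /base4_prefix big_ord_recr /= subnn expn0 muln1 big_distrr /=; congr addn.
by apply: eq_bigr => j _; rewrite subSn // expnS mulnCA.
Qed.

Section Expansions.
Variable R : realType.
Implicit Types (t : R) (u v : nat -> 'I_4).

Lemma series_base4 u n :
  series (fun i => (u i)%:R * (4 ^+ i.+1)^-1 : R) n = (base4_prefix u n)%:R / 4 ^+ n.
Proof.
elim: n => [|n IH].
  by rewrite /series /= big_geq // /base4_prefix big_ord0 mul0r.
rewrite seriesS IH base4_prefixS natrD natrM exprS.
by field; rewrite expf_neq0.
Qed.

Lemma expansion_exists u : exists2 t : R, base4_expansions t u & 0 <= t <= 1.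
Proof.
pose S := series (fun i => (u i)%:R * (4 ^+ i.+1)^-1 : R).
have S01 n : 0 <= S n <= 1.
  rewrite /S series_base4; apply/andP; split; first by rewrite divr_ge0 ?exprn_ge0.
  rewrite ler_pdivrMr ?exprn_gt0 // mul1r -natrX ler_nat ltnW //.
  exact: base4_prefix_lt.
have nd : nondecreasing_seq S.
  by apply: nondecreasing_series => i _ _; rewrite mulr_ge0 ?invr_ge0 ?exprn_ge0.
have bd : has_ubound (range S) by exists 1 => _ [n _ <-]; case/andP: (S01 n).
have cv := nondecreasing_is_cvgn nd bd.
exists (limn S) => //; apply/andP; split.
  by apply: limr_ge => //; near=> n; case/andP: (S01 n).
by apply: limr_le => //; near=> n; case/andP: (S01 n).
Unshelve. all: by end_near. Qed.

Lemma expansion_gt0 u t k : base4_expansions t u -> u k != ord0 -> 0 < t.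
Proof.
move=> ut uk; pose S := series (fun i => (u i)%:R * (4 ^+ i.+1)^-1 : R).
have nd : nondecreasing_seq S.
  by apply: nondecreasing_series => i _ _; rewrite mulr_ge0 ?invr_ge0 ?exprn_ge0.
have Sk : 0 < S k.+1.
  rewrite /S series_base4 divr_gt0 ?exprn_gt0 // ltr0n base4_prefixS addn_gt0.
  by rewrite orbC lt0n; move: uk; rewrite -val_eqE /= => ->.
apply: lt_le_trans Sk _.
have <- := cvg_lim (@Rhausdorff R) ut.
by apply: nondecreasing_cvgn_le => //; apply/cvg_ex; exists t.
Qed.

(** Two expansions of the same number differ by a carry. The difference [D n] of
    the integers formed by the first [n] digits satisfies
    [D n.+1 = 4 * D n + (v n - u n)]. It is positive after the first difference
    of the digits; if it reached [2], it would grow like [4 ^ n], and the values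
    would differ. So it stays [1], which determines all later digits. *)
Lemma expansion_tails u v t k : base4_expansions t u -> base4_expansions t v ->
  (forall j, (j < k)%N -> u j = v j) -> (u k < v k)%N ->
  v k = (u k).+1 :> nat /\
  forall j, (k < j)%N -> u j = ord_max /\ v j = ord0.
Proof.
move=> ut vt uv ltk.
pose D n : int := (base4_prefix v n)%:Z - (base4_prefix u n)%:Z.
have DS n : D n.+1 = 4 * D n + ((v n)%:Z - (u n)%:Z).
  by rewrite /D !base4_prefixS; lia.
have Dcvg : ((D n)%:~R / 4 ^+ n : R) @[n --> \oo] --> (0 : R).
  rewrite (_ : (fun n => _) = series (fun i => (v i)%:R * (4 ^+ i.+1)^-1 : R) -
      series (fun i => (u i)%:R * (4 ^+ i.+1)^-1 : R)).
    by rewrite -(subrr t); apply: (@cvgB _ R^o).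
  apply/funext => n; transitivity ((base4_prefix v n)%:R / 4 ^+ n -
      (base4_prefix u n)%:R / 4 ^+ n : R); last by rewrite -!series_base4.
  by rewrite /D intrB mulrBl.
have Dk : D k = 0.
  rewrite /D /base4_prefix; apply/eqP; rewrite subr_eq0; apply/eqP; congr Posz.
  by apply: eq_bigr => j _; rewrite uv.
have D1 n : (k < n)%N -> 1 <= D n.
  elim: n => // n IH; rewrite ltnS leq_eqVlt => /orP[/eqP <-|/IH h].
    by rewrite DS Dk; lia.
  by rewrite DS; have := ltn_ord (u n); lia.
have D2 n : D n <= 1.
  rewrite leNgt; apply/negP => D2n.
  have grow m : 4 ^+ m < D (n + m)%N.
    elim: m => [|m IH]; first by rewrite addn0 expr0.
    by rewrite addnS DS exprS; have := ltn_ord (u (n + m)%N); lia.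
  move/cvgrPdist_lt: Dcvg => /(_ (4 ^+ n)^-1); rewrite invr_gt0 exprn_gt0 // => /(_ isT).
  move=> [N _ hN]; have := hN (n + N)%N (leq_addl _ _).
  rewrite /= sub0r normrN normrM normfV [`|4 ^+ _|]ger0_norm ?exprn_ge0 //.
  rewrite ltr_pdivrMr ?exprn_gt0 // exprD mulKf ?expf_neq0 // ltNge => /negP; apply.
  rewrite -intr_norm; apply: le_trans (_ : (4 ^+ N : int)%:~R <= _); first by rewrite rmorphXn.
  by rewrite ler_int; apply: le_trans (ler_norm _); exact: ltW.
split.
  by have := D2 k.+1; rewrite DS Dk; lia.
move=> j kj; have := D2 j.+1; have := D1 j kj; have := D1 j.+1 (ltnW kj); rewrite DS.
have := ltn_ord (u j); have := ltn_ord (v j) => lv lu a b c.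
by split; apply: val_inj => /=; lia.
Unshelve. all: by end_near. Qed.

End Expansions.

Lemma ord2_eq (a b c : 'I_2) : a <> c -> b <> c -> a = b.
Proof.
move=> /eqP ac /eqP bc; apply: val_inj; move: ac bc; rewrite -!val_eqE /=.
by have := ltn_ord a; have := ltn_ord b; have := ltn_ord c; lia.
Qed.

(** * Consequences of injectivity *)

Section Parameterisation.
Variables (R : realType) (p : R).
Hypothesis hp : 1 / 4 < p <= 1 / 3.
Local Notation q := (qpar p).

(** Expansions that differ by a carry describe the common point of two
    consecutive pieces, as the end of the first and the start of the second. *)
Lemma coding_carry o (u v : nat -> 'I_4) k : (forall j, (j < k)%N -> u j = v j) ->
  v k = (u k).+1 :> nat -> (forall j, (k < j)%N -> u j = ord_max /\ v j = ord0) ->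
  coding p (address u o) = coding p (address v o).
Proof.
elim: k o u v => [|k IH] o u v uv vk tail; rewrite (coding_address hp u) (coding_address hp v).
  rewrite (_ : (fun i => u i.+1) = fun=> ord_max); last by apply/funext => i; case: (tail i.+1).
  rewrite (_ : (fun i => v i.+1) = fun=> ord0); last by apply/funext => i; case: (tail i.+1).
  by rewrite coding_right // coding_left //; exact: phi_joint.
rewrite -(uv 0%N) //; congr phi.
by apply: IH => [j jk|//|j jk]; [exact: uv|exact: tail].
Qed.

Lemma coding_expansions o u v (t : R) : base4_expansions t u -> base4_expansions t v ->
  coding p (address u o) = coding p (address v o).
Proof.
move=> ut vt; have [->//|uv] := pselect (u = v).
have ex_diff : exists k, u k != v k.
  apply: contrapT => /forallNP h; apply: uv; apply/funext => k.
  by have /negP := h k; rewrite negbK => /eqP.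
case: (ex_minnP ex_diff) => k uvk kmin.
have eq j : (j < k)%N -> u j = v j.
  by apply: contraTeq => /kmin; rewrite leqNgt.
have [lt|gt|/val_inj e] := ltngtP (u k) (v k).
- by have [vk tail] := expansion_tails ut vt eq lt; exact: coding_carry eq vk tail.
- have eq' j : (j < k)%N -> v j = u j by move=> /eq.
  by have [vk tail] := expansion_tails vt ut eq' gt; rewrite (coding_carry o eq' vk tail).
- by rewrite e eqxx in uvk.
Qed.

Lemma rho_expansion s u (t : R) : base4_expansions t u ->
  rho p s t = coding p (address u (tree_of s)).
Proof.
move=> ut; rewrite /rho omega_address.
exact: coding_expansions (xgetI (fun=> ord0) ut) ut.
Qed.

(** All codes except that of the first point of a curve, which also belongs to
    another side of the snowflake. *)
Definition nontrivial (u : nat -> 'I_4) := exists k, u k != ord0.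

Definition codes_apart (o : tree) := forall u v, nontrivial u -> nontrivial v ->
  coding p (address u o) = coding p (address v o) ->
  exists2 t : R, base4_expansions t u & base4_expansions t v.

Definition sides_apart (a b : tree) := forall u v, nontrivial u -> nontrivial v ->
  coding p (address u a) <> f1 (coding p (address v b)).

Section Injective.
Variables (s t r : orientations).
Hypothesis hinj : {in `[0, 1[ &, injective (snowflake_param p s t r)}.

(** Each third of the parameter interval describes one side, in the direction
    opposite to that of the codes; the values of nontrivial codes correspond to
    the half-open thirds that together form [[0, 1)]. *)
Lemma param_s u (x : R) : base4_expansions x u -> 0 < x <= 1 ->
  snowflake_param p s t r ((1 - x) / 3) = coding p (address u (tree_of s)).
Proof.
move=> ux /andP[x0 x1]; rewrite /snowflake_param ifT; last by lra.
by rewrite -(rho_expansion _ ux); congr rho; field.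
Qed.

Lemma param_r u (x : R) : base4_expansions x u -> 0 < x <= 1 ->
  snowflake_param p s t r ((2 - x) / 3) = f2 (coding p (address u (tree_of r))).
Proof.
move=> ux /andP[x0 x1]; rewrite /snowflake_param ifF; last by apply/negbTE; rewrite -leNgt; lra.
rewrite ifT; last by lra.
by rewrite -(rho_expansion _ ux); congr (f2 (rho _ _ _)); field.
Qed.

Lemma param_t u (x : R) : base4_expansions x u -> 0 < x <= 1 ->
  snowflake_param p s t r ((3 - x) / 3) = f1 (coding p (address u (tree_of t))).
Proof.
move=> ux /andP[x0 x1]; rewrite /snowflake_param ifF; last by apply/negbTE; rewrite -leNgt; lra.
rewrite ifF; last by apply/negbTE; rewrite -leNgt; lra.
by rewrite -(rho_expansion _ ux); congr (f1 (rho _ _ _)); field.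
Qed.

Lemma nontrivial_expansion u : nontrivial u ->
  exists2 x : R, base4_expansions x u & 0 < x <= 1.
Proof.
move=> [k uk]; have [x ux /andP[_ x1]] := expansion_exists R u.
by exists x => //; rewrite x1 andbT; exact: expansion_gt0 ux uk.
Qed.

Let inI (x y : R) : 0 <= x < 1 -> 0 <= y < 1 ->
  snowflake_param p s t r x = snowflake_param p s t r y -> x = y.
Proof. by move=> hx hy; apply: hinj; rewrite in_itv. Qed.

Lemma injective_apart :
  [/\ codes_apart (tree_of s), codes_apart (tree_of t) & codes_apart (tree_of r)] /\
  [/\ sides_apart (tree_of s) (tree_of t), sides_apart (tree_of t) (tree_of r) &
      sides_apart (tree_of r) (tree_of s)].
Proof.
split; split=> u v /nontrivial_expansion[x ux hx] /nontrivial_expansion[y vy hy] e.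
- exists x => //; have : (1 - x) / 3 = (1 - y) / 3.
    apply: inI; [lra|lra|]; rewrite (param_s ux hx) (param_s vy hy); exact: e.
  by move=> xy; rewrite (_ : x = y) //; lra.
- exists x => //; have : (3 - x) / 3 = (3 - y) / 3.
    apply: inI; [lra|lra|]; rewrite (param_t ux hx) (param_t vy hy); congr f1; exact: e.
  by move=> xy; rewrite (_ : x = y) //; lra.
- exists x => //; have : (2 - x) / 3 = (2 - y) / 3.
    apply: inI; [lra|lra|]; rewrite (param_r ux hx) (param_r vy hy); congr f2; exact: e.
  by move=> xy; rewrite (_ : x = y) //; lra.
- have : (1 - x) / 3 = (3 - y) / 3; last by lra.
  by apply: inI; [lra|lra|]; rewrite (param_s ux hx) (param_t vy hy).
- have : (3 - x) / 3 = (2 - y) / 3; last by lra.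
  by apply: inI; [lra|lra|]; rewrite (param_t ux hx) (param_r vy hy) e f1_f1.
- have : (2 - x) / 3 = (1 - y) / 3; last by lra.
  by apply: inI; [lra|lra|]; rewrite (param_r ux hx) (param_s vy hy) e f2_f1.
Qed.

End Injective.

(** The tip of the first bump, as the end of the second quarter. *)
Definition tip (b : 'I_2) : plane R := phi p (digit1, b) (Pright R).

Definition tip_code : nat -> 'I_4 := scons digit1 (fun=> ord_max).

Definition prepend (w : seq 'I_4) (u : nat -> 'I_4) := foldr (@scons 'I_4) u w.

Lemma coding_tip o : coding p (address tip_code o) = tip (o [::]).
Proof. by rewrite coding_address_scons // coding_right. Qed.

Lemma coding_prepend w u o : coding p (address (prepend w u) o) =
  cylmap p o w (coding p (address u (subtree o w))).
Proof.
elim: w o => //= d w IH o.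
by rewrite coding_address_scons // IH -subtree_cat.
Qed.

Lemma prependE w u i : prepend w u (size w + i) = u i.
Proof. by elim: w => //= d w IH; rewrite addSn. Qed.

Lemma prepend_lt w u v j : (j < size w)%N -> prepend w u j = prepend w v j.
Proof. by elim: w j => // d w IH [|j] //=; exact: IH. Qed.

Lemma nontrivial_tip w : nontrivial (prepend w tip_code).
Proof. by exists (size w + 0)%N; rewrite prependE. Qed.

Lemma tipE b : tip b = (0 : R, q * (bump_sign R b / 2) : R).
Proof.
by rewrite /tip (PrightE p) phiE //=; congr (_, q * _); field.
Qed.

Lemma flip_tip b : flip (tip b) = tip b.
Proof. by rewrite tipE /flip /= oppr0. Qed.

Lemma cylmap_last nu n o o' z :
  mirror nu (cylmap p o (nseq n ord_max) z) = cylmap p o' (nseq n ord_max) (mirror nu z).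
Proof.
elim: n o o' => //= n IH o o'.
by rewrite (mirror_phi _ _ _ (o' [::])) (IH _ (subtree o' [:: ord_max])).
Qed.

Lemma cylmap_first n o z :
  cylmap p o (nseq n ord0) z = flip (cylmap p (revtree o) (nseq n ord_max) (flip z)).
Proof.
elim: n o => [|n IH] o /=; first by rewrite flipK.
rewrite flip_phi // IH subtree_revtree /= /revtree /=.
rewrite (_ : rev_ord ord_max = ord0) //; exact: val_inj.
Qed.

(** If the mirror passes through the tip, it fixes the tip and all its images
    under the homothety at [Pright]: they belong to both arms. *)
Lemma cylmap_tip nu n o o' b : tilt nu (tip b) = 0 ->
  cylmap p o (nseq n ord_max) (tip b) =
  mirror nu (flip (cylmap p o' (nseq n ord0) (tip b))).
Proof.
move=> /mirror_fixed tb; rewrite cylmap_first flipK flip_tip.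
by rewrite (cylmap_last nu n _ o) tb.
Qed.

Lemma bump_sign_neq (b e : 'I_2) : b <> e -> bump_sign R b = - bump_sign R e.
Proof.
by case: b e => [[|[|]] // ?] [[|[|]] // ?] h; rewrite /bump_sign /= ?expr0 ?expr1 ?opprK //;
  case: h; exact: val_inj.
Qed.

Lemma tilt_tip (b e : 'I_2) : p = 1 / 3 -> b <> e ->
  tilt (- bump_sign R e * (3 * q)) (tip b) = 0.
Proof.
move=> p3 /bump_sign_neq be; rewrite tipE /tilt /= be.
rewrite (_ : _ * (3 * q) * _ = bump_sign R e ^+ 2 * (q * q) * 3 / 2); last by field.
by rewrite (sqr_q hp) bump_sign_sqr p3; field.
Qed.

(** If the bumps [w 1 3^n] and [w 2 0^n] point towards each other, they have the
    tip in common. The codes of the tip in the two pieces first differ after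
    [w], where they have the digits [1] and [2]; as the first one has another
    digit [1] later, they do not differ by a carry. *)
Lemma codes_apart_apices o : codes_apart o -> apices_avoid p o.
Proof.
move=> ho p3 w n [h1 h2].
pose u := prepend w (scons digit1 (prepend (nseq n ord_max) tip_code)).
pose v := prepend w (scons digit2 (prepend (nseq n ord0) tip_code)).
have ntu : nontrivial u by exists (size w + 0)%N; rewrite /u prependE.
have ntv : nontrivial v by exists (size w + 0)%N; rewrite /v prependE.
have b12 : o (w ++ digit2 :: nseq n ord0) = o (w ++ digit1 :: nseq n ord_max).
  exact: ord2_eq h2 h1.
have [|t ut vt] := ho u v ntu ntv.
  rewrite !coding_prepend !coding_address_scons // !coding_prepend !coding_tip.
  rewrite -!subtree_cat /= /subtree !cats0 -!catA /= b12; congr cylmap.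
  set b := o (w ++ _) in h1 *.
  rewrite (cylmap_tip _ _ (fun v0 : seq 'I_4 => o ((w ++ [:: digit2]) ++ v0)) (tilt_tip p3 h1)).
  have := apex_joint hp (o w).
  rewrite (_ : _ / _ * q = - bump_sign R (o w) * (3 * q)); last by rewrite p3; field.
  by move=> <-; rewrite flipK.
have eq j : (j < size w)%N -> u j = v j by exact: prepend_lt.
have uw : u (size w) = digit1 by rewrite -[size w]addn0 /u prependE.
have vw : v (size w) = digit2 by rewrite -[size w]addn0 /v prependE.
have lt : (u (size w) < v (size w))%N by rewrite uw vw.
have [_ tail] := expansion_tails ut vt eq lt.
have [] := tail (size w + n.+1)%N; first by rewrite -addn1 leq_add2l.
have := prependE (nseq n ord_max) tip_code 0; rewrite size_nseq addn0 => un.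
by rewrite /u prependE /= un.
Qed.

(** Two small bumps pointing into the triangle would put the same tip on two
    sides of the snowflake. *)
Lemma sides_apart_corner a b : sides_apart a b -> corner_avoids p a b.
Proof.
move=> hab p3 n [h1 h2].
apply: (hab _ _ (nontrivial_tip (nseq n ord_max)) (nontrivial_tip (nseq n ord0))).
rewrite !coding_prepend !coding_tip /subtree !cats0.
have -> : b (nseq n ord0) = a (nseq n ord_max).
  exact: ord2_eq h2 h1.
rewrite (cylmap_tip _ _ b (tilt_tip p3 h1)).
rewrite (_ : - _ * _ = - Num.sqrt 3); last first.
  by rewrite (sqrt3_tight hp p3) /bump_sign expr0 mulN1r.
by rewrite -f1_flip flipK.
Qed.

End Parameterisation.

Lemma koch_curveE (R : realType) (p : R) s : koch_curve p s = curve p (tree_of s).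
Proof.
by apply/seteqP; split=> _ [u _ <-]; exists u; rewrite // omega_address.
Qed.

Theorem theorem3p3 (R : realType) (p : R) (s t r : orientations)
    (hp : 1 / 4 < p <= 1 / 3)
    (hinj : {in `[0, 1[ &, injective (snowflake_param p s t r)}) :
  bounded_turning (koch_snowflake p s t r).
Proof.
have [[hs ht hr] [hst htr hrs]] := injective_apart hp hinj.
rewrite /koch_snowflake !koch_curveE.
by apply: (snowflake_turning hp); (exact: codes_apart_apices || exact: sides_apart_corner).
Qed.
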